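(* Let $\mathbb F$ be a maximal flag manifold with set of positive roots $\Pi^+=\{\alpha_1,\dots,\alpha_d\}$, $|\Pi^+|=d$. Then $$\mathfrak M_a(\mathbb F)=\prod_{\alpha\in\Pi^+}\mathfrak M_\alpha(\mathbb F)=(\mathbb R^\ast\cup\{\pm\mathbf 0\})_{\alpha_1}\times\cdots\times(\mathbb R^\ast\cup\{\pm\mathbf 0\})_{\alpha_d},$$ where $\alpha_j\in\Pi^+$. Moreover, in the product topology, $\mathfrak M_a(\mathbb F)$ contains an open dense subset $(\mathbb R^\ast)^d$ parametrizing all invariant generalized almost complex structures of symplectic type, and there are exactly $2^d$ isolated points corresponding to the structures of complex type.
   Context: Setting. $\mathfrak g$ is the Lie algebra of a complex semisimple Lie group $G$, $\mathfrak h\subset\mathfrak g$ a Cartan subalgebra, $\Pi$ the set of roots, $\Pi^+$ a choice of positive roots with simple system $\Sigma$, $\langle\cdot,\cdot\rangle$ the Cartan–Killing form, $H_\alpha\in\mathfrak h$ defined by $\alpha=\langle H_\alpha,\cdot\rangle$, $\mathfrak h_{\mathbb R}$ the real span of the $H_\alpha$, and $X_\alpha\in\mathfrak g_\alpha$ a Weyl basis ($\langle X_\alpha,X_{-\alpha}\rangle=1$, $[X_\alpha,X_\beta]=m_{\alpha,\beta}X_{\alpha+\beta}$ with $m_{\alpha,\beta}\in\mathbb R$, $m_{-\alpha,-\beta}=-m_{\alpha,\beta}$, and $m_{\alpha,\beta}=0$ if $\alpha+\beta$ is not a root). Put $A_\alpha=X_\alpha-X_{-\alpha}$, $S_\alpha=i(X_\alpha+X_{-\alpha})$,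 $\mathfrak u_\alpha=\mathrm{span}_{\mathbb R}\{A_\alpha,S_\alpha\}$. The compact real form is $\mathfrak u=i\mathfrak h_{\mathbb R}\oplus\bigoplus_{\alpha\in\Pi^+}\mathfrak u_\alpha$, with group $U=\exp\mathfrak u$ and maximal torus $T$, $\mathrm{Lie}(T)=\mathfrak t=i\mathfrak h_{\mathbb R}$. The maximal flag manifold is $\mathbb F=U/T$ with origin $b_0$, and $T_{b_0}\mathbb F=\mathfrak n^-:=\bigoplus_{\alpha\in\Pi^+}\mathfrak u_\alpha$. Fix a regular $H\in\mathfrak t$; $\omega_{b_0}(X,Y)=\langle H,[X,Y]\rangle$ is the Kirillov–Kostant–Souriau (KKS) form, $k_\alpha=\frac1{2i\langle H,H_\alpha\rangle}$, and for $X\in\mathfrak u_\alpha$ put $X^\ast=k_\alpha\omega_{b_0}(X,\cdot)\in\mathfrak u_\alpha^\ast$; $(-S_\alpha^\ast,A_\alpha^\ast)$ is the basis dual to $(A_\alpha,S_\alpha)$. Generalized structures. $T\mathbb F\oplus T^\ast\mathbb F$ carries $\langle X+\xi,Y+\eta\rangle=\frac12(\xi(Y)+\eta(X))$. A generalized almost complex structure is a bundle isometry $\mathbb J$ of $T\mathbb F\oplus T^\ast\mathbb F$ with $\mathbb J^2=-1$. $U$-invariant ones are identified with their value at $b_0$, an orthogonal complex structure on $\mathfrak n^-\oplus(\mathfrak n^-)^\ast$ commuting with the adjoint action of $T$. Every invariant one splits as $\mathbb J=\bigoplus_{\alpha\in\Pi^+}\mathbb J_\alpha$, with $\mathbb J_\alpha$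 acting on $\mathfrak u_\alpha\oplus\mathfrak u_\alpha^\ast$; in the basis $(A_\alpha,S_\alpha,-S_\alpha^\ast,A_\alpha^\ast)$, $\mathbb J_\alpha$ is either of complex type, $\mathbb J_\alpha=\pm\mathcal J_0$, or of noncomplex type, $\mathbb J_\alpha=\mathcal J_\alpha$, where $$\mathcal J_0=\begin{pmatrix}0&-1&0&0\\ 1&0&0&0\\ 0&0&0&-1\\ 0&0&1&0\end{pmatrix},\qquad \mathcal J_\alpha=\begin{pmatrix}a_\alpha&0&0&-x_\alpha\\ 0&a_\alpha&x_\alpha&0\\ 0&-y_\alpha&-a_\alpha&0\\ y_\alpha&0&0&-a_\alpha\end{pmatrix},$$ with $a_\alpha,x_\alpha,y_\alpha\in\mathbb R$, $a_\alpha^2=x_\alpha y_\alpha-1$ (all such choices occur). A noncomplex type component with $a_\alpha=0$ is of symplectic type, and every noncomplex type component is a $B$-transform of one of symplectic type with the same $x_\alpha$. In the quotient below, a class is of symplectic type when all its components are of noncomplex type, and of complex type when all its components are of complex type. Moduli. A 2-form $B$ acts by $e^B(X+\xi)=X+\xi+i_XB$, and on structures by $e^B\cdot\mathbb J=e^{-B}\mathbb Je^B$. $\mathfrak M_a(\mathbb F)$ is the quotient of the set of all invariant generalized almost complex structures on $\mathbb F$ by the action of invariant 2-forms $B\in\bigwedge^2(\mathfrak n^-)^\ast$. $\mathfrak M_\alpha(\mathbb F)$ is the quotient of the set of the structures $\mathbb J_\alpha$ on $\mathfrak u_\alpha\oplus\mathfrak u_\alpha^\ast$ by the action of $\bigwedge^2\mathfrak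 u_\alpha^\ast$; it is identified with $\mathbb R^\ast\cup\{\pm\mathbf 0\}$ ($\mathbb R^\ast=\mathbb R\setminus\{0\}$), the class of $\mathcal J_\alpha$ being the parameter $x_\alpha\in\mathbb R^\ast$ and the class of $\pm\mathcal J_0$ being the point $\pm\mathbf 0$. The two points $\pm\mathbf 0$ are isolated in $\mathfrak M_\alpha(\mathbb F)$.
   Formalization: Density of (R* )^d fails in the product topology for d ≥ 1, since the points ±0 are isolated; it is instead proved in the coarser topology of the coordinates x_α (with ±0 both over x_α = 0). Openness and the 2^d isolated points are proved in the product topology. *)

(* Defs.v *)
From HB Require Import structures.
From mathcomp Require Import all_boot all_order all_algebra.
From mathcomp Require Import complex.
From mathcomp Require Import all_classical all_reals all_analysis.

Set Implicit Arguments.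
Unset Strict Implicit.
Unset Printing Implicit Defensive.

Import Order.TTheory GRing.Theory Num.Theory.
Import numFieldNormedType.Exports.

Local Open Scope classical_set_scope.
Local Open Scope quotient_scope.
Local Open Scope complex_scope.
Local Open Scope ring_scope.

(* The complex vector space V regarded as a real vector space. *)
Definition realif (R : rcfType) (V : vectType R[i]) : Type := V.

Section Realification.
Import VectorInternalTheory.
Variables (R : rcfType) (V : vectType R[i]).
Local Notation W := (realif V).

HB.instance Definition _ := GRing.Zmodule.on W.

Definition realif_scale (a : R) (v : W) : W := a%:C *: (v : V).

Lemma realif_scaleA a b v :
  realif_scale a (realif_scale b v) = realif_scale (a * b) v.
Proof. by rewrite /realif_scale scalerA rmorphM. Qed.

Lemma realif_scale1 : left_id 1 realif_scale.
Proof. by move=> v; rewrite /realif_scale rmorph1 scale1r. Qed.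

Lemma realif_scaleDr : right_distributive realif_scale +%R.
Proof. by move=> a u v; rewrite /realif_scale scalerDr. Qed.

Lemma realif_scaleDl v : {morph realif_scale^~ v : a b / a + b}.
Proof. by move=> a b; rewrite /realif_scale rmorphD scalerDl. Qed.

HB.instance Definition _ := GRing.Zmodule_isLmodule.Build R W
  realif_scaleA realif_scale1 realif_scaleDr realif_scaleDl.

Let n := @dim _ V.

Definition realif_v2r (v : W) : 'rV[R]_(n + n) :=
  row_mx (map_mx (@complex.Re R) (v2r (v : V))) (map_mx (@complex.Im R) (v2r (v : V))).

Definition realif_r2v (w : 'rV[R]_(n + n)) : W :=
  (@r2v _ V (\row_j (lsubmx w 0 j +i* rsubmx w 0 j)) : V).

Lemma realif_vect : Vector.axiom (n + n) W.
Proof.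
exists realif_v2r; last first.
  exists realif_r2v => [v|w]; rewrite /realif_v2r /realif_r2v.
    rewrite row_mxKl row_mxKr -[RHS]v2rK; congr r2v.
    by apply/rowP => j; rewrite !mxE; case: (v2r _ 0 j).
  rewrite r2vK -[RHS]hsubmxK.
  by congr row_mx; apply/rowP => j; rewrite !mxE.
move=> a u v; rewrite /realif_v2r scale_row_mx add_row_mx.
have -> : (a *: u + v : W) = (a%:C *: (u : V) + v : V) by [].
rewrite linearP.
by congr row_mx; apply/rowP => j; rewrite !mxE;
  case: (v2r u 0 j) => x y; case: (v2r v 0 j) => x' y'; rewrite /=;
  rewrite mul0r ?subr0 ?addr0.
Qed.

HB.instance Definition _ := Lmodule_hasFinDim.Build R W realif_vect.

End Realification.

Section LieAlgebra.
Variables (K : fieldType) (g : vectType K) (br : g -> g -> g).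

Definition lie_bracket : Prop :=
  [/\ forall x, linear (br x), forall y, linear (br^~ y),
      forall x, br x x = 0
    & forall x y z, br x (br y z) + br y (br z x) + br z (br x y) = 0].

Definition ad (x : g) : 'End(g) := linfun (br x).

Definition lftrace (f : 'End(g)) : K :=
  \sum_(i < \dim {:g}) coord (vbasis {:g}) i (f (vbasis {:g})`_i).

Definition killing (x y : g) : K := lftrace (ad x \o ad y)%VF.

Definition brv (U V : {vspace g}) : {vspace g} :=
  <<[seq br x y | x <- vbasis U, y <- vbasis V]>>%VS.

Definition solvable (U : {vspace g}) : Prop :=
  exists n, iter n (fun V => brv V V) U = 0%VS.

Definition semisimple : Prop :=
  forall I : {vspace g}, (brv {:g} I <= I)%VS -> solvable I -> I = 0%VS.

Definition cartan_subalgebra (h : {vspace g}) : Prop :=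
  [/\ (brv h h <= h)%VS, exists n, iter n (brv h) h = 0%VS
    & forall x, (forall y, y \in h -> br x y \in h) -> x \in h].

Definition root (h : {vspace g}) (alpha : 'Hom(subvs_of h, K^o)) : Prop :=
  alpha != 0 /\
  exists2 x : g, x != 0 & forall H : subvs_of h, br (vsval H) x = alpha H *: x.

End LieAlgebra.

(* exp(f) = sum_k f^k / k!, the limit being taken coordinatewise. *)
Definition lfexp (R : realType) (W : vectType R) (f : W -> W) (v : W) : W :=
  \sum_(i < \dim {:W})
    limn (fun n => coord (vbasis {:W}) i
                     (\sum_(k < n) k`!%:R^-1 *: iter k f v) : R)
    *: (vbasis {:W})`_i.

Section GeneralizedLinearAlgebra.
Variables (R : realType) (V : vectType R).

Definition gen : Type := (V * 'Hom(V, R^o))%type.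
HB.instance Definition _ := Vector.on gen.

Definition gpair (p q : gen) : R := 2^-1 * (p.2 q.1 + q.2 p.1).

Definition gacs (J : 'End(gen)) : Prop :=
  (forall p, J (J p) = - p) /\ (forall p q, gpair (J p) (J q) = gpair p q).

(* A bilinear form b is encoded by X |-> i_X b. *)
Definition bform : Type := 'Hom(V, 'Hom(V, R^o)).
HB.instance Definition _ := Vector.on bform.

Definition expB (b : bform) (p : gen) : gen := (p.1, p.2 + b p.1).

Definition alternating (b : bform) : Prop := forall X, b X X = 0.

(* T plays the role of the Lie algebra of a torus and rho H that of the action *)
(* of exp H, so that rho (- H) is the inverse of rho H.                        *)
Variables (T : zmodType) (tor : set T) (rho : T -> 'End(V)).

Definition gact (H : T) (p : gen) : gen := (rho H p.1, (p.2 \o rho (- H))%VF).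

Definition inv_gacs : set 'End(gen) :=
  [set J | gacs J /\
     forall H, tor H -> forall p, J (gact H p) = gact H (J p)].

Definition inv_form (b : bform) : Prop :=
  forall H, tor H -> forall X Y, b (rho H X) (rho H Y) = b X Y.

End GeneralizedLinearAlgebra.

(* The quotient of a set S of structures by the B-transforms with B in G. *)
Section Moduli.
Variables (R : realType) (V : vectType R).

Record form_group := FormGroup {
  fgset : set (bform V);
  fg0 : fgset 0;
  fgD : forall b c, fgset b -> fgset c -> fgset (b + c);
  fgN : forall b, fgset b -> fgset (- b) }.

Variables (S : set 'End(gen V)) (G : form_group).

Definition Bequiv (J J' : S) : bool :=
  `[< exists2 b, fgset G b & forall p, val J' p = expB (- b) (val J (expB b p)) >].

Lemma expBD (b c : bform V) p : expB b (expB c p) = expB (b + c) p.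
Proof. by rewrite /expB /= add_lfunE -addrA [c _ + _]addrC. Qed.

Lemma expB0 p : expB (0 : bform V) p = p.
Proof. by case: p => X xi; rewrite /expB /= zero_lfunE addr0. Qed.

Lemma Bequiv_refl : reflexive Bequiv.
Proof.
move=> J; apply/asboolP; exists 0; first exact: fg0.
by move=> p; rewrite oppr0 !expB0.
Qed.

Lemma Bequiv_sym : symmetric Bequiv.
Proof.
move=> J J'; apply/asboolP/asboolP => -[b Gb e]; exists (- b);
  try exact: fgN; by move=> p; rewrite e opprK !expBD subrr !expB0.
Qed.

Lemma Bequiv_trans : transitive Bequiv.
Proof.
move=> J2 J1 J3 /asboolP[b Gb e] /asboolP[c Gc e']; apply/asboolP.
exists (b + c); first exact: fgD.
by move=> p; rewrite e' e !expBD opprD [- c - b]addrC.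
Qed.

Canonical Bequiv_equiv := EquivRel Bequiv Bequiv_refl Bequiv_sym Bequiv_trans.

Definition moduli : Type := {eq_quot Bequiv}.
HB.instance Definition _ := Choice.on moduli.

Definition cls (J : S) : moduli := \pi_({eq_quot Bequiv}) J.

End Moduli.

Section FormGroups.
Variables (R : realType) (V : vectType R).

Program Definition alt_forms : form_group V :=
  @FormGroup R V (@alternating R V) _ _ _.
Next Obligation. by move=> X; rewrite !zero_lfunE. Qed.
Next Obligation.
by move=> b c hb hc X; rewrite !add_lfunE hb hc addr0.
Qed.
Next Obligation. by move=> b hb X; rewrite !opp_lfunE hb oppr0. Qed.

Variables (T : zmodType) (tor : set T) (rho : T -> 'End(V)).

Program Definition inv_alt_forms : form_group V :=
  @FormGroup R V [set b | alternating b /\ inv_form tor rho b] _ _ _.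
Next Obligation.
by split=> [X|H _ X Y]; rewrite !zero_lfunE.
Qed.
Next Obligation.
move=> b c [hb ib] [hc ic].
by split=> [X|H tH X Y]; rewrite !add_lfunE ?hb ?hc ?addr0 ?ib ?ic.
Qed.
Next Obligation.
move=> b [hb ib].
by split=> [X|H tH X Y]; rewrite !opp_lfunE ?hb ?oppr0 ?ib.
Qed.

End FormGroups.

(* i times the real span of s *)
Definition iRspan (R : realType) (g : vectType R[i]) (s : seq g) :
    {vspace realif g} :=
  (linfun (fun v : realif g => ('i *: (v : g) : realif g))
     @: <<(s : seq (realif g))>>)%VS.

(* The fields Hr, Xr, mr and Hreg are the H_alpha, the Weyl basis X_alpha, its *)
(* structure constants m_(alpha, beta) and the regular element H. Hr, Xr and   *)
(* mr are only meaningful on roots.                                            *)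
Record flag_datum (R : realType) (d : nat) := FlagDatum {
  lie : vectType R[i];
  br : lie -> lie -> lie;
  br_lie : lie_bracket br;
  br_semisimple : semisimple br;
  cartan : {vspace lie};
  cartanP : cartan_subalgebra br cartan;
  roots : seq 'Hom(subvs_of cartan, R[i]^o);
  roots_uniq : uniq roots;
  rootsP : forall alpha, alpha \in roots <-> root br alpha;
  simple : seq 'Hom(subvs_of cartan, R[i]^o);
  simple_sub : {subset simple <= roots};
  simple_basis : basis_of fullv simple;
  simpleP : forall alpha, alpha \in roots -> exists n : nat -> nat,
    let beta := \sum_(i < size simple) (n i)%:R *: simple`_i in
    alpha = beta \/ alpha = - beta;
  pos : d.-tuple 'Hom(subvs_of cartan, R[i]^o);
  pos_uniq : uniq pos;
  posP : forall alpha, alpha \in pos <->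
    alpha \in roots /\ exists n : nat -> nat,
      alpha = \sum_(i < size simple) (n i)%:R *: simple`_i;
  Hr : 'Hom(subvs_of cartan, R[i]^o) -> lie;
  Hr_in : forall alpha, alpha \in roots -> Hr alpha \in cartan;
  HrP : forall alpha, alpha \in roots -> forall H : subvs_of cartan,
    alpha H = killing br (Hr alpha) (vsval H);
  Xr : 'Hom(subvs_of cartan, R[i]^o) -> lie;
  Xr_in : forall alpha, alpha \in roots -> forall H : subvs_of cartan,
    br (vsval H) (Xr alpha) = alpha H *: Xr alpha;
  (* the X_alpha and a basis of the Cartan subalgebra form a basis *)
  Xr_span : (cartan + <<[seq Xr alpha | alpha <- roots]>>)%VS = fullv;
  Xr_killing : forall alpha, alpha \in roots ->
    killing br (Xr alpha) (Xr (- alpha)) = 1;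
  mr : 'Hom(subvs_of cartan, R[i]^o) -> 'Hom(subvs_of cartan, R[i]^o) -> R;
  (* alpha + beta = 0 is excluded: [X_alpha, X_(- alpha)] is H_alpha *)
  Xr_br : forall alpha beta, alpha \in roots -> beta \in roots ->
    alpha + beta != 0 ->
    br (Xr alpha) (Xr beta) = (mr alpha beta)%:C *: Xr (alpha + beta);
  mr_opp : forall alpha beta, alpha \in roots -> beta \in roots ->
    mr (- alpha) (- beta) = - mr alpha beta;
  mr_notin : forall alpha beta, alpha \in roots -> beta \in roots ->
    alpha + beta \notin roots -> mr alpha beta = 0;
  Hreg : realif lie;
  Hreg_in : Hreg \in iRspan [seq Hr alpha | alpha <- roots];
  Hreg_regular : forall alpha, alpha \in roots ->
    alpha (vsproj cartan (Hreg : lie)) != 0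
}.

Section Flag.
Variables (R : realType) (d : nat) (F : flag_datum R d).
Local Notation g := (lie F).
Local Notation gR := (realif (lie F)).

Definition wA (j : 'I_d) : gR := Xr (tnth (pos F) j) - Xr (- tnth (pos F) j).

Definition wS (j : 'I_d) : gR :=
  'i *: (Xr (tnth (pos F) j) + Xr (- tnth (pos F) j) : g).

Definition uroot (j : 'I_d) : {vspace gR} := <<[:: wA j; wS j]>>%VS.

Definition nminus : {vspace gR} := (\sum_(j < d) uroot j)%VS.

(* i h_R, the Lie algebra of the maximal torus *)
Definition tor : set gR :=
  [set H | H \in iRspan [seq Hr alpha | alpha <- roots F]].

(* Ad(exp H) restricted to a subspace U stable under the torus; the projection *)
(* onto U only serves to get a total definition.                               *)
Definition AdT (U : {vspace gR}) (H : gR) : 'End(subvs_of U) :=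
  linfun (fun v => vsproj U (lfexp (br (H : g) : gR -> gR) (vsval v))).

Definition Na : vectType R := subvs_of nminus.
Definition Ua (j : 'I_d) : vectType R := subvs_of (uroot j).

Definition Ja : set 'End(gen Na) := inv_gacs tor (AdT nminus).
Definition Jroot (j : 'I_d) : set 'End(gen (Ua j)) :=
  inv_gacs tor (AdT (uroot j)).
Arguments Jroot : clear implicits.

Definition Ma : Type := moduli Ja (inv_alt_forms tor (AdT nminus)).
Definition Mroot (j : 'I_d) : Type := moduli (Jroot j) (alt_forms (Ua j)).

(* The inclusion of u_j (+) u_j^* in n^- (+) (n^-)^*; linear forms on u_j are  *)
(* extended by zero on the other summands of n^-.                              *)
Definition gincl (j : 'I_d) (p : gen (Ua j)) : gen Na :=
  (vsproj nminus (vsval p.1),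
   linfun (fun v : Na => p.2 (vsproj (uroot j) (sumv_pi nminus j (vsval v))))).

Definition splits (J : Ja) (Js : forall j, Jroot j) : Prop :=
  forall j p, val J (gincl p) = gincl (val (Js j) p).

Definition kks (X Y : g) : R[i] := killing (@br _ _ F) (Hreg F : g) (br X Y).

Definition kcoef (j : 'I_d) : R[i] :=
  (2 * 'i * killing (@br _ _ F) (Hreg F : g) (Hr (tnth (pos F) j)))^-1.

(* k_alpha * kks X Y is real for X and Y in u_alpha. *)
Definition star (j : 'I_d) (X : g) : 'Hom(Ua j, R^o) :=
  linfun (fun Y : Ua j => (complex.Re (kcoef j * kks X (vsval Y)) : R^o)).

Definition frame (j : 'I_d) : 4.-tuple (gen (Ua j)) :=
  [tuple (vsproj (uroot j) (wA j), 0); (vsproj (uroot j) (wS j), 0);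
         (0, - star j (wS j)); (0, star j (wA j))].

Definition has_matrix (j : 'I_d) (J : 'End(gen (Ua j))) (M : 'M[R]_4) : Prop :=
  forall l, J (tnth (frame j) l) = \sum_(k < 4) M k l *: tnth (frame j) k.

End Flag.
Arguments Ja {R d} F _.
Arguments Jroot {R d} F j _.

Section Types.
Variable R : realType.

Definition mx4 (s : seq (seq R)) : 'M[R]_4 :=
  \matrix_(k < 4, l < 4) (nth [::] s k)`_l.

Definition cJ0 : 'M[R]_4 := mx4
  [:: [:: 0; -1; 0;  0];
      [:: 1;  0; 0;  0];
      [:: 0;  0; 0; -1];
      [:: 0;  0; 1;  0] ].

Definition ncJ (a x y : R) : 'M[R]_4 := mx4
  [:: [:: a;   0;   0; - x];
      [:: 0;   a;   x;   0];
      [:: 0; - y; - a;   0];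
      [:: y;   0;   0; - a] ].

Variables (d : nat) (F : flag_datum R d).

Definition complex_type (j : 'I_d) (J : Jroot F j) : Prop :=
  has_matrix (val J) cJ0 \/ has_matrix (val J) (- cJ0).

Definition noncomplex_type (j : 'I_d) (J : Jroot F j) : Prop :=
  exists a x y, a ^+ 2 = x * y - 1 /\ has_matrix (val J) (ncJ a x y).

Definition symplectic_classes : set (Ma F) :=
  [set m | exists J Js,
     [/\ m = cls _ J, splits J Js & forall j, noncomplex_type (Js j)]].

Definition complex_classes : set (Ma F) :=
  [set m | exists J Js,
     [/\ m = cls _ J, splits J Js & forall j, complex_type (Js j)]].

(* R^* u {+0, -0}: the disjoint union of the punctured line and of two         *)
(* isolated points, [zpt true] and [zpt false] standing for +0 and -0.         *)
Definition Rstar : topologicalType := set_type [set x : R | x != 0].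

Definition modsum (b : bool) : topologicalType :=
  if b then (bool : topologicalType) else Rstar.

Definition modspace : topologicalType := {b : bool & modsum b}.

Definition rpt (x : Rstar) : modspace := existT modsum false x.
Definition zpt (s : bool) : modspace := existT modsum true s.

Definition class_param (j : 'I_d) (J : Jroot F j) (p : modspace) : Prop :=
  match p with
  | existT false x => exists a y,
      a ^+ 2 = val x * y - 1 /\ has_matrix (val J) (ncJ a (val x) y)
  | existT true s => has_matrix (val J) (if s then cJ0 else - cJ0)
  end.

(* The (1, 4) and (2, 3) entries of the matrix of J are -x and x for ncJ a x y *)
(* and vanish for cJ0.                                                         *)
Definition xcoord (p : modspace) : R :=
  match p with existT false x => val x | existT true _ => 0 end.

End Types.

Arguments symplectic_classes {R d} F _.
Arguments complex_classes {R d} F _.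

Section ModuliTopology.
Variables (R : realType) (d : nat).

Definition modprod : topologicalType :=
  prod_topology (fun _ : 'I_d => modspace R).

Definition xcoords (p : modprod) :
    prod_topology (fun _ : 'I_d => (R : topologicalType)) :=
  fun j => xcoord (p j).

(* The coarser topology of the coordinates x_alpha, in which +0 and -0 both    *)
(* lie over x_alpha = 0. In the product topology of modprod the points +0 and  *)
(* -0 are isolated, so that no dense subset can avoid them.                    *)
Definition xtop : topologicalType := initial_topology xcoords.

End ModuliTopology.

(* Main.v *)
From HB Require Import structures.
From mathcomp Require Import all_boot all_order all_algebra.
From mathcomp Require Import complex.
From mathcomp Require Import all_classical all_reals all_analysis.
From mathcomp Require Import ring lra.
Require Import Defs.

Set Implicit Arguments.
Unset Strict Implicit.
Unset Printing Implicit Defensive.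

Import Order.TTheory GRing.Theory Num.Theory.
Import numFieldNormedType.Exports.

Local Open Scope classical_set_scope.
Local Open Scope complex_scope.
Local Open Scope ring_scope.

(** The torus T acts on n^- by rotations of the root planes u_al.  For this one
    needs al (H) to be purely imaginary for H in i h_R, that is <H al, H be> real:
    for be different from al and - al this is the Jacobi identity for X al,
    X (- al), X be, whose structure constants are real ([root_pair_jacobi]), and
    for be = al it follows from these cases or from the trace formula
    ([root_pair_self_real]).  Then ad H acts on u_al by theta times the quarter turn
    (A, S) |-> (S, - A), and exp (ad H) by the rotation of angle theta ([lfexp_rot]).

    Two distinct positive roots are neither equal nor opposite, so some H in the
    torus gives angles with different cosines ([cos_sep]); the planes u_al, and
    the blocks u_al + u_al^*, are therefore pairwise inequivalent representations
    of T, and an invariant structure J, or an invariant 2-form, is block diagonal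
    ([suppJ], [form_blockdiag]).  Within a block J commutes with the quarter turn,
    so it is a complex 2 by 2 matrix; skewness leaves the matrices
    ((a + i s, i x), (i y, - a + i s)) and J^2 = -1 leaves s = 0, x y = a^2 + 1 or
    a = x = y = 0, s^2 = 1 ([gacs_acts_as]).

    An invariant 2-form is a multiple of the area form on each plane, with
    independent coefficients.  Its B-transform fixes s and x, and when s = 0 it
    moves a to any given value, because x is then nonzero ([BequivP]).  So the class
    of a block is the sign s = 1, -1 or the number x in R^*, and the class of J is
    the family of classes of its blocks.  [moduli_param] proves this for any space
    with such rotating planes; it is applied to n^- and to each u_al, and the
    bijection with the product compares the two.

    The topological statements concern the product of d copies of
    R^* u {+0, -0} only: R^* is open without isolated points, +0 and -0 are
    isolated, and for the topology of the coordinates x_al the complement of the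
    coordinate hyperplanes of R^d is dense. *)

(** * Vector spaces with a rotation frame *)

Lemma linfunE (K : fieldType) (U W : vectType K) (f : U -> W) :
  linear f -> linfun f =1 f.
Proof.
move=> lf; pose L := GRing.isLinear.Build K U W _ f lf.
pose F : {linear U -> W} := HB.pack f L.
exact: (lfunE F).
Qed.

(** What is used of the tangent space of the flag manifold: it is a sum of
    planes, one for each index, with dual bases (eA, eS) and (cA, cS), on which
    the torus acts by rotations of angle [angle i].  [angle_sep] makes two
    different planes inequivalent, even as unoriented representations, and
    [angle_reg] makes each plane irreducible.  The same record describes a single
    root plane, with one index. *)
Record rotframe (R : realType) (V : vectType R) (T : zmodType) (tor : set T)
    (rho : T -> 'End(V)) (I : finType) := Rotframe {
  eA : I -> V;
  eS : I -> V;
  cA : I -> 'Hom(V, R^o);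
  cS : I -> 'Hom(V, R^o);
  cA_eA : forall i j, cA i (eA j) = (i == j)%:R;
  cA_eS : forall i j, cA i (eS j) = 0;
  cS_eA : forall i j, cS i (eA j) = 0;
  cS_eS : forall i j, cS i (eS j) = (i == j)%:R;
  frame_span : forall v, v = \sum_i (cA i v *: eA i + cS i v *: eS i);
  angle : I -> T -> R;
  rho_eA : forall i H, tor H ->
    rho H (eA i) = cos (angle i H) *: eA i + sin (angle i H) *: eS i;
  rho_eS : forall i H, tor H ->
    rho H (eS i) = - sin (angle i H) *: eA i + cos (angle i H) *: eS i;
  torN : forall H, tor H -> tor (- H);
  angleN : forall i H, tor H -> angle i (- H) = - angle i H;
  angle_sep : forall i j, i != j ->
    exists2 H, tor H & cos (angle i H) != cos (angle j H);
  angle_reg : forall i, exists2 H, tor H & sin (angle i H) != 0 }.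

Section Rotframe.
Variables (R : realType) (V : vectType R) (T : zmodType) (tor : set T).
Variables (rho : T -> 'End(V)) (I : finType) (f : rotframe tor rho I).
Local Notation eA := (eA f).
Local Notation eS := (eS f).
Local Notation cA := (cA f).
Local Notation cS := (cS f).
Local Notation th := (angle f).

(** The values yA and yS of a covector on eA i and eS i are its coordinates on
    cA i and cS i. *)
Definition xA (i : I) (p : gen V) : R := cA i p.1.
Definition xS (i : I) (p : gen V) : R := cS i p.1.
Definition yA (i : I) (p : gen V) : R := p.2 (eA i).
Definition yS (i : I) (p : gen V) : R := p.2 (eS i).

Lemma frame_lin (W : vectType R) (phi : 'Hom(V, W)) v :
  phi v = \sum_i (cA i v *: phi (eA i) + cS i v *: phi (eS i)).
Proof.
rewrite {1}(frame_span f v) linear_sum; apply: eq_bigr => i _.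
by rewrite linearD !linearZ.
Qed.

Lemma gen_ext (p q : gen V) :
  (forall i, [/\ xA i p = xA i q, xS i p = xS i q, yA i p = yA i q
               & yS i p = yS i q]) -> p = q.
Proof.
case: p q => [v xi] [w eta] e; congr (_, _).
  rewrite (frame_span f v) (frame_span f w); apply: eq_bigr => i _.
  by case: (e i); rewrite /xA /xS /= => -> -> _ _.
apply/lfunP => v'; rewrite !(frame_lin _ v'); apply: eq_bigr => i _.
by case: (e i); rewrite /yA /yS /= => _ _ -> ->.
Qed.

Lemma xA_lin i : linear (xA i : gen V -> R^o).
Proof. by move=> a p q; rewrite /xA /= linearP. Qed.
Lemma xS_lin i : linear (xS i : gen V -> R^o).
Proof. by move=> a p q; rewrite /xS /= linearP. Qed.
Lemma yA_lin i : linear (yA i : gen V -> R^o).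
Proof. by move=> a p q; rewrite /yA /= add_lfunE scale_lfunE. Qed.
Lemma yS_lin i : linear (yS i : gen V -> R^o).
Proof. by move=> a p q; rewrite /yS /= add_lfunE scale_lfunE. Qed.

HB.instance Definition _ i := GRing.isLinear.Build R (gen V) R^o _ (xA i) (xA_lin i).
HB.instance Definition _ i := GRing.isLinear.Build R (gen V) R^o _ (xS i) (xS_lin i).
HB.instance Definition _ i := GRing.isLinear.Build R (gen V) R^o _ (yA i) (yA_lin i).
HB.instance Definition _ i := GRing.isLinear.Build R (gen V) R^o _ (yS i) (yS_lin i).

Lemma sum_delta (g : I -> R) i : \sum_j g j * (i == j)%:R = g i.
Proof.
rewrite (bigD1 i) //= eqxx mulr1 big1 ?addr0 // => j ji.
by rewrite eq_sym (negbTE ji) mulr0.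
Qed.

Definition genmk (u0 u1 u2 u3 : I -> R) : gen V :=
  (\sum_i (u0 i *: eA i + u1 i *: eS i), \sum_i (u2 i *: cA i + u3 i *: cS i)).

Lemma genmkK (u0 u1 u2 u3 : I -> R) i :
  [/\ xA i (genmk u0 u1 u2 u3) = u0 i, xS i (genmk u0 u1 u2 u3) = u1 i,
      yA i (genmk u0 u1 u2 u3) = u2 i & yS i (genmk u0 u1 u2 u3) = u3 i].
Proof.
split; rewrite /genmk /xA /xS /yA /yS /= ?linear_sum ?sum_lfunE.
- rewrite -[RHS](sum_delta u0); apply: eq_bigr => j _.
  by rewrite linearD !linearZ /= cA_eA cA_eS /GRing.scale /= mulr0 addr0.
- rewrite -[RHS](sum_delta u1); apply: eq_bigr => j _.
  by rewrite linearD !linearZ /= cS_eA cS_eS /GRing.scale /= mulr0 add0r.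
- rewrite -[RHS](sum_delta u2); apply: eq_bigr => j _.
  rewrite add_lfunE !scale_lfunE /= cA_eA cS_eA /GRing.scale /= mulr0 addr0.
  by rewrite eq_sym.
- rewrite -[RHS](sum_delta u3); apply: eq_bigr => j _.
  rewrite add_lfunE !scale_lfunE /= cA_eS cS_eS /GRing.scale /= mulr0 add0r.
  by rewrite eq_sym.
Qed.

Lemma gpairE (p q : gen V) : gpair p q =
  2^-1 * \sum_i (yA i p * xA i q + yS i p * xS i q
                 + yA i q * xA i p + yS i q * xS i p).
Proof.
rewrite /gpair (frame_lin p.2 q.1) (frame_lin q.2 p.1) -big_split /=; congr (_ * _).
apply: eq_bigr => i _; rewrite /GRing.scale /= /xA /xS /yA /yS; ring.
Qed.

(** The torus rotates the covector plane (cA i, cS i) by the same angle as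
    (eA i, eS i), so that a block carries two copies of one representation. *)
Lemma gact_coord H i p : tor H ->
  [/\ xA i (gact rho H p) = cos (th i H) * xA i p - sin (th i H) * xS i p,
      xS i (gact rho H p) = sin (th i H) * xA i p + cos (th i H) * xS i p,
      yA i (gact rho H p) = cos (th i H) * yA i p - sin (th i H) * yS i p
    & yS i (gact rho H p) = sin (th i H) * yA i p + cos (th i H) * yS i p].
Proof.
move=> tH; have tN := torN f tH; split; rewrite /gact /xA /xS /yA /yS /=.
- rewrite (frame_lin (rho H)) linear_sum /=.
  rewrite -[RHS](sum_delta (fun j => cos (th j H) * cA j p.1 - sin (th j H) * cS j p.1)).
  apply: eq_bigr => j _; rewrite (rho_eA f) // (rho_eS f) // !(linearD, linearZ) /=.
  rewrite cA_eA cA_eS /GRing.scale /=; ring.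
- rewrite (frame_lin (rho H)) linear_sum /=.
  rewrite -[RHS](sum_delta (fun j => sin (th j H) * cA j p.1 + cos (th j H) * cS j p.1)).
  apply: eq_bigr => j _; rewrite (rho_eA f) // (rho_eS f) // !(linearD, linearZ) /=.
  rewrite cS_eA cS_eS /GRing.scale /=; ring.
- rewrite comp_lfunE (rho_eA f) // angleN // cosN sinN linearD !linearZ /=.
  rewrite /GRing.scale /=; ring.
- rewrite comp_lfunE (rho_eS f) // angleN // cosN sinN linearD !linearZ /=.
  rewrite /GRing.scale /=; ring.
Qed.

(** With the plane identified with the complex numbers, eA = 1 and eS = i, an
    endomorphism commuting with rotations is a complex 2 by 2 matrix; being
    skew for the pairing forces the form ((a + i s, i x), (i y, - a + i s)).
    Hence four real parameters, common to the two types of the classification: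
    s = 0 in the noncomplex type, and s = 1 or s = -1, a = x = y = 0 in the
    complex type. *)
Record block := Block { blk_a : R; blk_s : R; blk_x : R; blk_y : R }.

(** The two solutions of J^2 = -1 for the complex 2 by 2 matrix of a block. *)
Definition block_ok (n : block) : Prop :=
  (blk_s n = 0 /\ blk_x n * blk_y n = blk_a n ^+ 2 + 1) \/
  [/\ blk_a n = 0, blk_x n = 0, blk_y n = 0 & blk_s n ^+ 2 = 1].

Definition acts_as (J : 'End(gen V)) (i : I) (n : block) : Prop := forall p,
  [/\ xA i (J p) = blk_a n * xA i p - blk_s n * xS i p - blk_x n * yS i p,
      xS i (J p) = blk_s n * xA i p + blk_a n * xS i p + blk_x n * yA i p,
      yA i (J p) = - (blk_y n * xS i p) - blk_a n * yA i p - blk_s n * yS i p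
    & yS i (J p) = blk_y n * xA i p + blk_s n * yA i p - blk_a n * yS i p].

Definition vecA i : gen V := (eA i, 0).
Definition vecS i : gen V := (eS i, 0).
Definition covA i : gen V := (0, cA i).
Definition covS i : gen V := (0, cS i).

Lemma vecA_coord i j : [/\ xA j (vecA i) = (j == i)%:R, xS j (vecA i) = 0,
  yA j (vecA i) = 0 & yS j (vecA i) = 0].
Proof. by split; rewrite /xA /xS /yA /yS /= ?cA_eA ?cS_eA ?zero_lfunE. Qed.
Lemma vecS_coord i j : [/\ xA j (vecS i) = 0, xS j (vecS i) = (j == i)%:R,
  yA j (vecS i) = 0 & yS j (vecS i) = 0].
Proof. by split; rewrite /xA /xS /yA /yS /= ?cA_eS ?cS_eS ?zero_lfunE. Qed.
Lemma covA_coord i j : [/\ xA j (covA i) = 0, xS j (covA i) = 0,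
  yA j (covA i) = (j == i)%:R & yS j (covA i) = 0].
Proof. by split; rewrite /xA /xS /yA /yS /= ?linear0 ?cA_eA ?cA_eS // eq_sym. Qed.
Lemma covS_coord i j : [/\ xA j (covS i) = 0, xS j (covS i) = 0,
  yA j (covS i) = 0 & yS j (covS i) = (j == i)%:R].
Proof. by split; rewrite /xA /xS /yA /yS /= ?linear0 ?cS_eA ?cS_eS // eq_sym. Qed.

Lemma gen_span p : p = \sum_i (xA i p *: vecA i + xS i p *: vecS i
                              + yA i p *: covA i + yS i p *: covS i).
Proof.
apply: gen_ext => i; rewrite !linear_sum.
have e := (fun j => (vecA_coord j i, vecS_coord j i, covA_coord j i, covS_coord j i)).
split.
- rewrite -[LHS](sum_delta (fun j => xA j p)); apply: eq_bigr => j _.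
  have [[[[a _ _ _] [b _ _ _]] [c _ _ _]] [d _ _ _]] := e j.
  by rewrite !(linearD, linearZ) /= a b c d /GRing.scale /= !mulr0 !addr0.
- rewrite -[LHS](sum_delta (fun j => xS j p)); apply: eq_bigr => j _.
  have [[[[_ a _ _] [_ b _ _]] [_ c _ _]] [_ d _ _]] := e j.
  by rewrite !(linearD, linearZ) /= a b c d /GRing.scale /= !mulr0 add0r !addr0.
- rewrite -[LHS](sum_delta (fun j => yA j p)); apply: eq_bigr => j _.
  have [[[[_ _ a _] [_ _ b _]] [_ _ c _]] [_ _ d _]] := e j.
  by rewrite !(linearD, linearZ) /= a b c d /GRing.scale /= !mulr0 !addr0 add0r.
- rewrite -[LHS](sum_delta (fun j => yS j p)); apply: eq_bigr => j _.
  have [[[[_ _ _ a] [_ _ _ b]] [_ _ _ c]] [_ _ _ d]] := e j.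
  by rewrite !(linearD, linearZ) /= a b c d /GRing.scale /= !mulr0 !addr0 add0r.
Qed.

End Rotframe.

(** * Invariant structures as families of 4 by 4 blocks *)

Section Classify.
Variables (R : realType) (V : vectType R) (T : zmodType) (tor : set T).
Variables (rho : T -> 'End(V)) (I : finType) (f : rotframe tor rho I).
Local Notation th := (angle f).

(** Each condition on J is a polynomial identity in the coordinates of one
    block. *)
Lemma acts_as_gacs (J : 'End(gen V)) (n : I -> block R) :
  (forall i, block_ok (n i)) -> (forall i, acts_as f J i (n i)) ->
  J \in inv_gacs tor rho.
Proof.
move=> ok a; rewrite inE; split; first split.
- move=> p; apply: (gen_ext (f := f)) => i.
  case: (a i (J p)) => -> -> -> ->; case: (a i p) => -> -> -> ->.
  rewrite !linearN /=; case: (ok i) => [[-> h]|[-> -> -> h]].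
    by split; ring: h.
  by split; ring: h.
- move=> p q; rewrite !(gpairE f); congr (_ * _); apply: eq_bigr => i _.
  case: (a i p) => -> -> -> ->; case: (a i q) => -> -> -> ->.
  by case: (ok i) => [[-> h]|[-> -> -> h]]; ring: h.
- move=> H tH p; apply: (gen_ext (f := f)) => i.
  case: (a i (gact rho H p)) => -> -> -> ->.
  case: (gact_coord f i (J p) tH) => -> -> -> ->.
  case: (gact_coord f i p tH) => -> -> -> ->.
  by case: (a i p) => -> -> -> ->; split; ring.
Qed.

Let xA_mk u0 u1 u2 u3 i : xA f i (genmk f u0 u1 u2 u3) = u0 i.
Proof. by case: (genmkK f u0 u1 u2 u3 i). Qed.
Let xS_mk u0 u1 u2 u3 i : xS f i (genmk f u0 u1 u2 u3) = u1 i.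
Proof. by case: (genmkK f u0 u1 u2 u3 i). Qed.
Let yA_mk u0 u1 u2 u3 i : yA f i (genmk f u0 u1 u2 u3) = u2 i.
Proof. by case: (genmkK f u0 u1 u2 u3 i). Qed.
Let yS_mk u0 u1 u2 u3 i : yS f i (genmk f u0 u1 u2 u3) = u3 i.
Proof. by case: (genmkK f u0 u1 u2 u3 i). Qed.

Definition of_blocks (n : I -> block R) : 'End(gen V) := linfun (fun p : gen V =>
  genmk f (fun i => blk_a (n i) * xA f i p - blk_s (n i) * xS f i p - blk_x (n i) * yS f i p)
          (fun i => blk_s (n i) * xA f i p + blk_a (n i) * xS f i p + blk_x (n i) * yA f i p)
          (fun i => - (blk_y (n i) * xS f i p) - blk_a (n i) * yA f i p - blk_s (n i) * yS f i p)
          (fun i => blk_y (n i) * xA f i p + blk_s (n i) * yA f i p - blk_a (n i) * yS f i p)).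

Lemma of_blocks_acts n i : acts_as f (of_blocks n) i (n i).
Proof.
move=> p; rewrite /of_blocks linfunE; last first.
  move=> c u v; apply: (gen_ext (f := f)) => j; rewrite !linearP /=.
  rewrite !(xA_mk, xS_mk, yA_mk, yS_mk).
  by rewrite !linearP /= /GRing.scale /=; split; ring.
exact: genmkK.
Qed.

Section FromStructure.
Variable J : 'End(gen V).
Hypothesis hJ : inv_gacs tor rho J.

Lemma gpairC (p q : gen V) : gpair p q = gpair q p.
Proof. by rewrite /gpair addrC. Qed.

(** For an isometry, J^2 = -1 says that the adjoint of J is - J. *)
Lemma gpair_skew p q : gpair (J p) q = - gpair p (J q).
Proof.
case: hJ => -[J2 Jo] _; rewrite -[LHS]Jo J2 /gpair /= opp_lfunE linearN /=.
by ring.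
Qed.

(* K and D multiply block i by 2 cos and by 2 sin times the quarter turn: the *)
(* first detects the block, the second the complex structure of a block.      *)
Let K H (p : gen V) := gact rho H p + gact rho (- H) p.
Let D H (p : gen V) := gact rho H p - gact rho (- H) p.

Lemma K_comm H p : tor H -> J (K H p) = K H (J p).
Proof.
case: hJ => _ c tH.
by rewrite /K (linearD J); congr (_ + _); apply: c => //; exact: torN f _ tH.
Qed.

Lemma D_comm H p : tor H -> J (D H p) = D H (J p).
Proof.
case: hJ => _ c tH.
by rewrite /D (linearB J); congr (_ - _); apply: c => //; exact: torN f _ tH.
Qed.

Lemma K_coord H i p : tor H ->
  [/\ xA f i (K H p) = 2 * cos (th i H) * xA f i p,
      xS f i (K H p) = 2 * cos (th i H) * xS f i p,
      yA f i (K H p) = 2 * cos (th i H) * yA f i p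
    & yS f i (K H p) = 2 * cos (th i H) * yS f i p].
Proof.
move=> tH; rewrite /K !linearD /=; case: (gact_coord f i p tH) => -> -> -> ->.
case: (gact_coord f i p (torN f tH)) => -> -> -> ->.
by rewrite angleN // cosN sinN; split; ring.
Qed.

Lemma D_coord H i p : tor H ->
  [/\ xA f i (D H p) = - (2 * sin (th i H) * xS f i p),
      xS f i (D H p) = 2 * sin (th i H) * xA f i p,
      yA f i (D H p) = - (2 * sin (th i H) * yS f i p)
    & yS f i (D H p) = 2 * sin (th i H) * yA f i p].
Proof.
move=> tH; rewrite /D !linearB /=; case: (gact_coord f i p tH) => -> -> -> ->.
case: (gact_coord f i p (torN f tH)) => -> -> -> ->.
by rewrite angleN // cosN sinN; split; ring.
Qed.

Let supp i p := forall j, j != i ->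
  [/\ xA f j p = 0, xS f j p = 0, yA f j p = 0 & yS f j p = 0].

(** J commutes with K, so it preserves the eigenspaces of K, and by [angle_sep]
    some K separates block j from block i. *)
Lemma suppJ i p : supp i p -> supp i (J p).
Proof.
move=> sp j ji; have [H tH ne] := angle_sep f ji.
have Kp : K H p = (2 * cos (th i H)) *: p.
  apply: (gen_ext (f := f)) => k; rewrite !linearZ /=.
  case: (K_coord k p tH) => -> -> -> ->; have [->|ki] := eqVneq k i.
    by split.
  by case: (sp k ki) => -> -> -> ->; rewrite /GRing.scale /= !mulr0.
have := K_comm p tH; rewrite Kp linearZ /= => e.
have z (u : R) : 2 * cos (th i H) * u = 2 * cos (th j H) * u -> u = 0.
  move=> h; have /eqP : (cos (th j H) - cos (th i H)) * u = 0 by lra.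
  by rewrite mulf_eq0 subr_eq0 (negbTE ne) => /eqP.
case: (K_coord j (J p) tH); rewrite -!e !linearZ /=.
by move=> /z -> /z -> /z -> /z ->.
Qed.

(** Here q is p turned by a right angle in block i; J commutes with D, hence
    with this quarter turn. *)
Lemma JD i p q : supp i p ->
  xA f i q = - xS f i p -> xS f i q = xA f i p -> yA f i q = - yS f i p -> yS f i q = yA f i p ->
  supp i q ->
  [/\ xA f i (J q) = - xS f i (J p), xS f i (J q) = xA f i (J p),
      yA f i (J q) = - yS f i (J p) & yS f i (J q) = yA f i (J p)].
Proof.
move=> sp e0 e1 e2 e3 sq; have [H tH s0] := angle_reg f i.
have Dp : D H p = (2 * sin (th i H)) *: q.
  apply: (gen_ext (f := f)) => k; rewrite !linearZ /=.
  case: (D_coord k p tH) => -> -> -> ->; rewrite /GRing.scale /=.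
  have [->|ki] := eqVneq k i; first by rewrite e0 e1 e2 e3; split; ring.
  by case: (sp k ki) => -> -> -> ->; case: (sq k ki) => -> -> -> ->; split; ring.
have := D_comm p tH; rewrite Dp linearZ /= => e.
have z (u v : R) : 2 * sin (th i H) * u = 2 * sin (th i H) * v -> u = v.
  by apply: mulfI; rewrite mulf_neq0 // pnatr_eq0.
case: (D_coord i (J p) tH); rewrite -!e !linearZ /GRing.scale /= => h0 h1 h2 h3.
by split; apply: z; [exact: h0|exact: h1|exact: h2|exact: h3].
Qed.

Lemma block_ok_of_eqs (p s q r : R) : -1 = p ^+ 2 - s ^+ 2 - q * r ->
  s * p *+ 2 = 0 -> s * q *+ 2 = 0 -> s * r *+ 2 = 0 -> block_ok (Block p s q r).
Proof.
move=> e sp sq sr; rewrite /block_ok /=; have [s0|sn0] := eqVneq s 0.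
  by left; split=> //; move: e; rewrite s0; lra.
have z (u : R) : s * u *+ 2 = 0 -> u = 0.
  by move/eqP; rewrite mulrn_eq0 /= mulf_eq0 (negbTE sn0) => /eqP.
by right; split; [exact: z|exact: z|exact: z|move: e; rewrite (z _ sp) (z _ sq); lra].
Qed.

(** Commutation with the quarter turn reduces J on block i to its values on
    vecA and covA, skewness leaves four of their eight coordinates free, and
    J^2 = -1 gives [block_ok]. *)
Lemma gacs_acts_as i : exists2 n, block_ok n & acts_as f J i n.
Proof.
have e j := (vecA_coord f j i, vecS_coord f j i, covA_coord f j i, covS_coord f j i).
have s0 j : supp j (vecA f j).
  by move=> k kj; case: (vecA_coord f j k) => -> -> -> ->; rewrite (negbTE kj).
have s1 j : supp j (vecS f j).
  by move=> k kj; case: (vecS_coord f j k) => -> -> -> ->; rewrite (negbTE kj).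
have s2 j : supp j (covA f j).
  by move=> k kj; case: (covA_coord f j k) => -> -> -> ->; rewrite (negbTE kj).
have s3 j : supp j (covS f j).
  by move=> k kj; case: (covS_coord f j k) => -> -> -> ->; rewrite (negbTE kj).
case: (vecA_coord f i i); case: (vecS_coord f i i); rewrite eqxx => f10 f11 f12 f13 f00 f01 f02 f03.
case: (covA_coord f i i); case: (covS_coord f i i); rewrite eqxx => f30 f31 f32 f33 f20 f21 f22 f23.
have [c10 c11 c12 c13] : [/\ xA f i (J (vecS f i)) = - xS f i (J (vecA f i)),
   xS f i (J (vecS f i)) = xA f i (J (vecA f i)), yA f i (J (vecS f i)) = - yS f i (J (vecA f i))
   & yS f i (J (vecS f i)) = yA f i (J (vecA f i))].
  by apply: JD; rewrite ?f00 ?f01 ?f02 ?f03 ?f10 ?f11 ?f12 ?f13 ?oppr0.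
have [c30 c31 c32 c33] : [/\ xA f i (J (covS f i)) = - xS f i (J (covA f i)),
   xS f i (J (covS f i)) = xA f i (J (covA f i)), yA f i (J (covS f i)) = - yS f i (J (covA f i))
   & yS f i (J (covS f i)) = yA f i (J (covA f i))].
  by apply: JD; rewrite ?f20 ?f21 ?f22 ?f23 ?f30 ?f31 ?f32 ?f33 ?oppr0.
have gp0 p : gpair p (vecA f i) = 2^-1 * yA f i p.
  by rewrite /gpair /vecA /= zero_lfunE addr0.
have gp1 p : gpair p (vecS f i) = 2^-1 * yS f i p.
  by rewrite /gpair /vecS /= zero_lfunE addr0.
have gp2 p : gpair p (covA f i) = 2^-1 * xA f i p.
  by rewrite /gpair /covA /= linear0 add0r.
have gp3 p : gpair p (covS f i) = 2^-1 * xS f i p.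
  by rewrite /gpair /covS /= linear0 add0r.
have r1 : yA f i (J (vecA f i)) = 0.
  have := gpair_skew (vecA f i) (vecA f i); rewrite [X in _ = - X]gpairC !gp0; lra.
have q1 : xA f i (J (covA f i)) = 0.
  have := gpair_skew (covA f i) (covA f i); rewrite [X in _ = - X]gpairC !gp2; lra.
have t1 : yA f i (J (covA f i)) = - xA f i (J (vecA f i)).
  have := gpair_skew (vecA f i) (covA f i); rewrite [X in _ = - X]gpairC gp2 gp0; lra.
have t2 : yS f i (J (covA f i)) = xS f i (J (vecA f i)).
  have := gpair_skew (vecA f i) (covS f i); rewrite [X in _ = - X]gpairC gp3 gp0 c32; lra.
pose n := Block (xA f i (J (vecA f i))) (xS f i (J (vecA f i)))
                (xS f i (J (covA f i))) (yS f i (J (vecA f i))).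
have an : acts_as f J i n.
  have loc (x : {linear gen V -> R^o}) q :
      (forall j q, supp j q -> j != i -> x q = 0) ->
      x (J q) = xA f i q * x (J (vecA f i)) + xS f i q * x (J (vecS f i))
       + yA f i q * x (J (covA f i)) + yS f i q * x (J (covS f i)).
    move=> hx; rewrite {1}(gen_span f q) !linear_sum /= (bigD1 i) //= big1 ?addr0.
      by rewrite !(linearD, linearZ).
    move=> j ji; rewrite !(linearD, linearZ) /=.
    by rewrite !(hx j) //; rewrite ?scaler0 ?addr0 //; exact: suppJ.
  move=> p.
  have h0 : forall j q, supp j q -> j != i -> xA f i q = 0.
    by move=> j q sq ji; case: (sq i); rewrite // eq_sym.
  have h1 : forall j q, supp j q -> j != i -> xS f i q = 0.
    by move=> j q sq ji; case: (sq i); rewrite // eq_sym.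
  have h2 : forall j q, supp j q -> j != i -> yA f i q = 0.
    by move=> j q sq ji; case: (sq i); rewrite // eq_sym.
  have h3 : forall j q, supp j q -> j != i -> yS f i q = 0.
    by move=> j q sq ji; case: (sq i); rewrite // eq_sym.
  split; [rewrite (loc (xA f i : {linear gen V -> R^o}) p h0)
    |rewrite (loc (xS f i : {linear gen V -> R^o}) p h1)
    |rewrite (loc (yA f i : {linear gen V -> R^o}) p h2)
    |rewrite (loc (yS f i : {linear gen V -> R^o}) p h3)]; rewrite /n /=.
  - by rewrite c10 c30 q1; ring.
  - by rewrite c11 c31 q1; ring.
  - by rewrite c12 c32 r1 t1 t2; ring.
  - by rewrite c13 c33 r1 t1 t2; ring.
exists n => //.
have J2 p : J (J p) = - p by case: hJ => -[].
have := an (J (vecA f i)); rewrite J2 !linearN /= f00 f01 f02 f03.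
have [e0 e1 e2 e3] := an (vecA f i); rewrite e0 e1 e2 e3 f00 f01 f02 f03 => -[h1 h2 h3 _].
have := an (J (covA f i)); rewrite J2 !linearN /= f20 f21 f22 f23.
have [g0 g1 g2 g3] := an (covA f i); rewrite g0 g1 g2 g3 f20 f21 f22 f23 => -[k1 k2 k3 k4].
apply: block_ok_of_eqs.
- by rewrite h1 /n /=; ring.
- by rewrite -[RHS]oppr0 h2 /n /=; ring.
- by apply/eqP; rewrite -oppr_eq0 -[X in _ == X]oppr0 k1 /n /=; apply/eqP; ring.
- by apply/eqP; rewrite -oppr_eq0 -[X in _ == X]oppr0 h3 /n /=; apply/eqP; ring.
Qed.

End FromStructure.
End Classify.

(** * Invariant 2-forms and the quotient by B-transforms *)

Section BTransforms.
Variables (R : realType) (V : vectType R) (T : zmodType) (tor : set T).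
Variables (rho : T -> 'End(V)) (I : finType) (f : rotframe tor rho I).
Local Notation th := (angle f).
Local Notation eA := (eA f).
Local Notation eS := (eS f).
Local Notation cA := (cA f).
Local Notation cS := (cS f).

Lemma form_expand (b : bform V) (X Y : V) :
  b X Y = \sum_i (cA i X * b (eA i) Y + cS i X * b (eS i) Y).
Proof.
rewrite (frame_lin f b X) sum_lfunE; apply: eq_bigr => i _.
by rewrite add_lfunE !scale_lfunE.
Qed.

Lemma alternating_anti (b : bform V) (X Y : V) : alternating b -> b X Y = - b Y X.
Proof.
move=> ab; have := ab (X + Y); rewrite (linearD b) add_lfunE !linearD /= !ab.
by move=> /eqP; rewrite add0r addr0 addr_eq0 => /eqP.
Qed.

Definition form_coef (b : bform V) i : R := b (eA i) (eS i).

(** Invariance makes rho H + rho (- H) self-adjoint for b.  It acts on plane i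
    as 2 cos (angle i H), and for some H the factors of planes i and j differ. *)
Lemma form_blockdiag (b : bform V) : inv_form tor rho b ->
  forall i j, i != j -> forall X Y : V, X \in [:: eA i; eS i] -> Y \in [:: eA j; eS j] ->
  b X Y = 0.
Proof.
move=> ib i j ij X Y hX hY; have [H tH ne] := angle_sep f ij.
have tN := torN f tH.
pose K := rho H + rho (- H).
have l (x y x' : R) (u v : V) : x = x' -> y = 0 -> x *: u + y *: v = x' *: u.
  by move=> -> ->; rewrite scale0r addr0.
have r (x y y' : R) (u v : V) : x = 0 -> y = y' -> x *: u + y *: v = y' *: v.
  by move=> -> ->; rewrite scale0r add0r.
have KX k Z : Z \in [:: eA k; eS k] -> K Z = (2 * cos (th k H)) *: Z.
  rewrite !inE => /orP[]/eqP->; rewrite /K add_lfunE ?(rho_eA f, rho_eS f) //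
    angleN // cosN sinN addrACA -!scalerDl; [apply: l|apply: r]; ring.
have rK k Z H' : tor H' -> Z \in [:: eA k; eS k] -> rho (- H') (rho H' Z) = Z.
  move=> tH' hZ; move: (cos2Dsin2 (th k H')) => cs; have tN' := torN f tH'.
  move: hZ; rewrite !inE => /orP[]/eqP->; rewrite ?(rho_eA f, rho_eS f) //
    linearD !linearZ /= ?(rho_eA f, rho_eS f) // angleN // cosN sinN !scalerDr
    !scalerA addrACA -!scalerDl -[RHS]scale1r -cs; [apply: l|apply: r]; ring.
have e : b (K X) Y = b X (K Y).
  rewrite /K !add_lfunE (linearD b) add_lfunE linearD /= addrC.
  have e1 := rK i X (- H) tN hX; rewrite opprK in e1.
  rewrite -(ib H tH (rho (- H) X) Y) e1.
  by rewrite -(ib (- H) tN (rho H X) Y) (rK i).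
move: e; rewrite (KX i X hX) (KX j Y hY) !linearZ scale_lfunE => e.
have e2 : 2 * cos (th i H) * (b X Y : R) = 2 * cos (th j H) * (b X Y : R) by exact: e.
move: e2; set u : R := b X Y => e2.
have /eqP : (cos (th i H) - cos (th j H)) * u = 0 by lra.
by rewrite mulf_eq0 subr_eq0 (negbTE ne) => /eqP.
Qed.

(** On each plane b is a multiple of the area form, so that the B-transform
    adds to the covector part a multiple of the vector part turned by a right
    angle. *)
Lemma inv_form_coord (b : bform V) : alternating b -> inv_form tor rho b ->
  forall i p, [/\ xA f i (expB b p) = xA f i p, xS f i (expB b p) = xS f i p,
      yA f i (expB b p) = yA f i p - form_coef b i * xS f i p
    & yS f i (expB b p) = yS f i p + form_coef b i * xA f i p].
Proof.
move=> ab ib i p; rewrite /xA /xS /yA /yS /expB /=; split=> //.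
- rewrite add_lfunE (form_expand b p.1) (bigD1 i) //= big1 ?addr0.
    by rewrite ab mulr0 add0r (alternating_anti (eS i) _ ab) mulrN mulrC.
  move=> j ji; rewrite !(form_blockdiag ib ji); rewrite ?inE ?eqxx ?orbT //.
  by rewrite !mulr0 addr0.
- rewrite add_lfunE (form_expand b p.1) (bigD1 i) //= big1 ?addr0.
    by rewrite ab mulr0 addr0 mulrC.
  move=> j ji; rewrite !(form_blockdiag ib ji); rewrite ?inE ?eqxx ?orbT //.
  by rewrite !mulr0 addr0.
Qed.

Definition form_of_coef (be : I -> R) : bform V := linfun (fun X : V =>
  \sum_i (be i * cA i X) *: cS i - \sum_i (be i * cS i X) *: cA i).

Lemma form_of_coefE be (X Y : V) :
  form_of_coef be X Y = \sum_i be i * (cA i X * cS i Y - cS i X * cA i Y).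
Proof.
rewrite /form_of_coef linfunE; last first.
  move=> c u v; rewrite scalerBr addrACA -opprD !scaler_sumr -!big_split /=.
  congr (_ - _); apply: eq_bigr => i _; rewrite linearP /= scalerA -scalerDl;
    congr (_ *: _); rewrite /GRing.scale /=; ring.
rewrite add_lfunE opp_lfunE !sum_lfunE -sumrB; apply: eq_bigr => i _.
by rewrite !scale_lfunE /GRing.scale /=; ring.
Qed.

Lemma form_of_coef_alt be : alternating (form_of_coef be).
Proof.
by move=> X; rewrite form_of_coefE big1 // => i _; ring.
Qed.

(** Rotations preserve the area form of each plane. *)
Lemma form_of_coef_inv be : inv_form tor rho (form_of_coef be).
Proof.
move=> H tH X Y; rewrite !form_of_coefE; apply: eq_bigr => i _; congr (_ * _).
have [e0 e1 _ _] := gact_coord f i (X, 0) tH.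
have [g0 g1 _ _] := gact_coord f i (Y, 0) tH.
move: e0 e1 g0 g1; rewrite /xA /xS /= => -> -> -> ->.
have := cos2Dsin2 (th i H) => cs.
rewrite -[RHS]mul1r -cs; ring.
Qed.

Lemma form_of_coefK be i : form_coef (form_of_coef be) i = be i.
Proof.
rewrite /form_coef form_of_coefE -[RHS](sum_delta be); apply: eq_bigr => j _.
rewrite cA_eA cS_eS cS_eA mul0r subr0 [j == i]eq_sym.
by case: (i == j); rewrite ?mulr1 ?mulr0.
Qed.

(** The block of exp(- B) J exp(B) for B equal to t times the area form: in the
    complex 2 by 2 notation, the conjugate by ((1, 0), (i t, 1)). *)
Definition bshift (t : R) (n : block R) : block R :=
  Block (blk_a n - t * blk_x n) (blk_s n) (blk_x n) (blk_y n - 2 * t * blk_a n + t ^+ 2 * blk_x n).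

Lemma acts_as_expB (J J' : 'End(gen V)) (b : bform V) i n :
  alternating b -> inv_form tor rho b ->
  (forall p, J' p = expB (- b) (J (expB b p))) -> acts_as f J i n ->
  acts_as f J' i (bshift (form_coef b i) n).
Proof.
move=> ab ib e a p; rewrite e.
have ab' : alternating (- b) by move=> X; rewrite !opp_lfunE ab oppr0.
have ib' : inv_form tor rho (- b) by move=> H tH X Y; rewrite !opp_lfunE ib.
have [-> -> -> ->] := inv_form_coord ab' ib' i (J (expB b p)).
have -> : form_coef (- b) i = - form_coef b i by rewrite /form_coef !opp_lfunE.
have [-> -> -> ->] := a (expB b p).
have [-> -> -> ->] := inv_form_coord ab ib i p.
by split; rewrite /=; ring.
Qed.

Lemma acts_as_inj (J : 'End(gen V)) i n n' : acts_as f J i n -> acts_as f J i n' -> n = n'.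
Proof.
move=> a a'.
have [e0 e1 _ e3] := a (vecA f i); have [g0 g1 _ g3] := a' (vecA f i).
move: e0 e1 e3; rewrite g0 g1 g3.
have [_ e1 _ _] := a (covA f i); have [_ g1' _ _] := a' (covA f i).
move: e1; rewrite g1'.
have [c0 c1 c2 c3] := vecA_coord f i i; have [d0 d1 d2 d3] := covA_coord f i i.
rewrite !(c0, c1, c2, c3, d0, d1, d2) eqxx !mulr0 !mulr1 !subr0 !addr0 !add0r.
by case: n n' {a a' g0 g1 g3 g1'} => [p s q r] [p' s' q' r'] /= -> -> -> ->.
Qed.

(** The parameters s and x are the invariants of a block under B-transforms. *)
Definition same_class (n n' : block R) : Prop := blk_s n = blk_s n' /\ blk_x n = blk_x n'.

(** If s = 0 then x is nonzero, so that t = (a - a') / x moves a to a', and then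
    x y = a^2 + 1 determines y.  If s is nonzero there is nothing to move. *)
Lemma same_class_bshift (n n' : block R) : block_ok n -> block_ok n' -> same_class n n' ->
  exists t, n' = bshift t n.
Proof.
case: n n' => [p s q r] [p' s' q' r']; rewrite /same_class /block_ok /=.
move=> ok ok' [e e']; subst s' q'.
case: ok ok' => [[s0 qr]|[p0 q0 r0 s1]] [[s0' qr']|[p0' q0' r0' s1']].
- have q0 : q != 0.
    apply: contra_eqN qr => /eqP ->; rewrite mul0r eq_sym lt0r_neq0 //.
    by rewrite ltr_wpDl // sqr_ge0.
  exists ((p - p') / q); rewrite /bshift /=.
  have -> : r = (p ^+ 2 + 1) / q by rewrite -qr mulrAC mulfV // mul1r.
  have -> : r' = (p' ^+ 2 + 1) / q by rewrite -qr' mulrAC mulfV // mul1r.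
  by congr Block; field.
- by move: s1'; rewrite s0 expr0n /= => /eqP; rewrite eq_sym oner_eq0.
- by move: s1; rewrite s0' expr0n /= => /eqP; rewrite eq_sym oner_eq0.
- by exists 0; rewrite /bshift /= p0 p0' q0 r0 r0'; congr Block; ring.
Qed.

Lemma bshift_same t n : same_class n (bshift t n).
Proof. by []. Qed.

Definition block_point (n : block R) (p : modspace R) : Prop :=
  match p with
  | existT false x => blk_s n = 0 /\ blk_x n = val x
  | existT true s => blk_s n = if s then 1 else -1
  end.

Definition sgnb (s : bool) : R := if s then 1 else -1.

Lemma sgnb_inj : injective sgnb.
Proof. by case=> [] [] //; rewrite /sgnb => h; exfalso; lra. Qed.

Lemma block_x_neq0 (n : block R) : block_ok n -> blk_s n = 0 -> blk_x n != 0.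
Proof.
case=> [[s0 qr] _|[_ _ _ s1 s0]].
  apply: contra_eqN qr => /eqP ->; rewrite mul0r eq_sym lt0r_neq0 //.
  by rewrite ltr_wpDl // sqr_ge0.
by move: s1; rewrite s0 expr0n /= => /eqP; rewrite eq_sym oner_eq0.
Qed.

Lemma block_point_ex (n : block R) : block_ok n -> exists p, block_point n p.
Proof.
move=> ok; case: (ok) => [[s0 qr]|[p0 q0 r0 /eqP s1]].
  have q0 := block_x_neq0 ok s0.
  have q0' : blk_x n \in [set x : R | x != 0] by rewrite inE.
  by exists (rpt (exist _ (blk_x n) q0')).
move: s1; rewrite sqrf_eq1 => /orP[]/eqP s1.
  by exists (zpt R true).
by exists (zpt R false).
Qed.

Lemma block_point_same n n' p : block_ok n -> block_ok n' ->
  block_point n p -> block_point n' p -> same_class n n'.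
Proof.
rewrite /same_class; case: p => -[] c ok ok' /=; last first.
  by move=> [-> ->] [-> ->].
move=> e e'; split; first by rewrite e.
case: ok => [[s0 _]|[_ -> _ _]].
  by move: e; rewrite s0; case: (c) => h; exfalso; lra.
case: ok' => [[s0 _]|[_ -> _ _]] //.
by move: e'; rewrite s0; case: (c) => h; exfalso; lra.
Qed.

Lemma same_block_point n n' p p' :
  block_point n p -> block_point n' p' -> same_class n n' -> p = p'.
Proof.
case: p p' => -[] c [[] c'] /=.
- by move=> e e' [h _]; congr existT; apply: sgnb_inj; rewrite /sgnb -e -e'.
- by move=> e [e' _] [h _]; exfalso; move: h; rewrite e e'; case: (c) => h; lra.
- by move=> [e _] e' [h _]; exfalso; move: h; rewrite e e'; case: (c') => h; lra.
- by move=> [_ e] [_ e'] [_ h]; congr existT; apply: val_inj; rewrite /= -e -e'.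
Qed.

Lemma block_point_surj p : exists2 n, block_ok n & block_point n p.
Proof.
case: p => -[] c /=.
  exists (Block 0 (sgnb c) 0 0) => //; right; split => //=.
  by case: (c); rewrite /sgnb /= ?sqrrN expr1n.
have c0 : val c != 0 by have := valP c; rewrite inE.
exists (Block 0 0 (val c) (val c)^-1) => //; left; split => //=.
by rewrite mulfV // expr0n /= add0r.
Qed.

Section Moduli.
Variable G : form_group V.
Hypothesis GE : forall b, fgset G b <-> alternating b /\ inv_form tor rho b.
Local Notation S := (inv_gacs tor rho).

(** An invariant B acts on the blocks separately, with an arbitrary coefficient
    on each of them: this is why the quotient is a product. *)
Lemma BequivP (J J' : S) (n n' : I -> block R) :
  (forall i, acts_as f (val J) i (n i)) -> (forall i, acts_as f (val J') i (n' i)) ->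
  (forall i, block_ok (n i)) -> (forall i, block_ok (n' i)) ->
  Bequiv G J J' <-> forall i, same_class (n i) (n' i).
Proof.
move=> a a' ok ok'; split.
  move=> /asboolP[b /GE[ab ib] e] i.
  have a'' := acts_as_expB ab ib e (a i).
  by rewrite (acts_as_inj (a' i) a''); exact: bshift_same.
move=> sc; apply/asboolP.
have t i : {t | n' i = bshift t (n i)}.
  by apply: cid; exact: same_class_bshift.
have [ab ib] := (form_of_coef_alt (fun i => sval (t i)), form_of_coef_inv (fun i => sval (t i))).
set b := form_of_coef _ in ab ib.
exists b; first by apply/GE.
pose b' := - b.
have ab' : alternating b' by move=> X; rewrite !opp_lfunE ab oppr0.
have ib' : inv_form tor rho b' by move=> H tH X Y; rewrite !opp_lfunE ib.
move=> p; apply: (gen_ext (f := f)) => i.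
have [-> -> -> ->] := inv_form_coord ab' ib' i (val J (expB b p)).
have -> : form_coef b' i = - form_coef b i by rewrite /form_coef !opp_lfunE.
have [-> -> -> ->] := a i (expB b p).
have [-> -> -> ->] := inv_form_coord ab ib i p.
have [-> -> -> ->] := a' i p.
by rewrite form_of_coefK; case: (t i) => u /= -> /=; split; ring.
Qed.

Lemma gacs_blocks (J : S) : exists n : I -> block R,
  forall i, block_ok (n i) /\ acts_as f (val J) i (n i).
Proof.
have hJ : inv_gacs tor rho (val J) by have := valP J; rewrite inE.
exists (fun i => s2val (cid2 (gacs_acts_as f hJ i))) => i.
by case: cid2.
Qed.

Lemma inj_surj_bij (X Y : Type) (h : X -> Y) :
  injective h -> (forall y, exists x, h x = y) -> bijective h.
Proof.
move=> hi hs; exists (fun y => sval (cid (hs y))) => [x|y].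
  by apply: hi; case: cid.
by case: cid.
Qed.

(** The common form of the two identifications of the theorem: used with all
    positive roots it describes the moduli of the flag manifold, with a single
    index the moduli of a root plane. *)
Lemma moduli_param : exists Psi : moduli S G -> I -> modspace R,
  bijective Psi /\ forall (J : S) i, exists n,
    [/\ block_ok n, acts_as f (val J) i n & block_point n (Psi (cls G J) i)].
Proof.
pose n (J : S) := sval (cid (gacs_blocks J)).
have nP (J : S) i : block_ok (n J i) /\ acts_as f (val J) i (n J i).
  exact: (svalP (cid (gacs_blocks J)) i).
pose c (J : S) i := sval (cid (block_point_ex (nP J i).1)).
have cP J i : block_point (n J i) (c J i) by exact: svalP (cid _).
have cE (J J' : S) : Bequiv G J J' <-> c J = c J'.
  split=> [|e].
    move/(BequivP (fun i => (nP J i).2) (fun i => (nP J' i).2)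
       (fun i => (nP J i).1) (fun i => (nP J' i).1)) => sc.
    by apply/funext => i; exact: same_block_point (cP J i) (cP J' i) (sc i).
  apply/(BequivP (fun i => (nP J i).2) (fun i => (nP J' i).2)
       (fun i => (nP J i).1) (fun i => (nP J' i).1)) => i.
  apply: (@block_point_same _ _ (c J i)); rewrite ?(nP _ _).1 //; try exact: (nP _ i).1.
  by rewrite e; exact: cP.
have clsE (J J' : S) : Bequiv G J J' <-> cls G J = cls G J'.
  by split; [move=> h; apply/eqmodP|move=> /eqmodP].
exists (fun m => c (repr m)); split; last first.
  move=> J i; exists (n J i); split; [exact: (nP J i).1|exact: (nP J i).2|].
  have <- : c J = c (repr (cls G J)) by apply/cE/clsE; rewrite /cls reprK.
  exact: cP.
apply: inj_surj_bij => [m m'|p].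
  by move/cE/clsE; rewrite /cls !reprK.
pose n' i := s2val (cid2 (block_point_surj (p i))).
have ok i : block_ok (n' i) by rewrite /n'; case: cid2.
have pP i : block_point (n' i) (p i) by rewrite /n'; case: cid2.
have JS : of_blocks f n' \in S by exact: (acts_as_gacs ok (of_blocks_acts f n')).
pose J : S := SigSub JS.
exists (cls G J); have <- : c J = c (repr (cls G J)) by apply/cE/clsE; rewrite /cls reprK.
apply/funext => i; apply: same_block_point (cP J i) (pP i) _.
by rewrite (acts_as_inj (nP J i).2 (of_blocks_acts f n' i)).
Qed.

End Moduli.
End BTransforms.

(** * Traces, brackets and the Killing form *)

Section Trace.
Variables (K : fieldType) (V : vectType K).
Local Notation b := (vbasis {:V}).

Lemma coord_fullv (v : V) : v = \sum_i coord b i v *: b`_i.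
Proof. by apply: coord_vbasis; rewrite memvf. Qed.

Lemma lftrace_comp (f g : 'End(V)) : lftrace (f \o g)%VF = lftrace (g \o f)%VF.
Proof.
have E (u w : 'End(V)) : lftrace (u \o w)%VF =
    \sum_(i < \dim {:V}) \sum_(j < \dim {:V}) coord b j (w b`_i) * coord b i (u b`_j).
  apply: eq_bigr => i _; rewrite comp_lfunE {1}(coord_fullv (w b`_i)).
  by rewrite !linear_sum; apply: eq_bigr => j _; rewrite !linearZ.
rewrite !E exchange_big; apply: eq_bigr => i _; apply: eq_bigr => j _.
by rewrite mulrC.
Qed.

Lemma lftraceD (f g : 'End(V)) : lftrace (f + g) = lftrace f + lftrace g.
Proof.
rewrite /lftrace -big_split /=; apply: eq_bigr => i _.
by rewrite add_lfunE linearD.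
Qed.

Lemma lftraceZ c (f : 'End(V)) : lftrace (c *: f) = c * lftrace f.
Proof.
by rewrite /lftrace mulr_sumr; apply: eq_bigr => i _; rewrite scale_lfunE linearZ.
Qed.

(** The trace of a sum of rank one maps, for a family w that need not be a
    basis. *)
Lemma lftrace_sum (I : Type) (s : seq I) (phi : I -> 'Hom(V, K^o)) (w : I -> V)
    (f : 'End(V)) :
  (forall v, f v = \sum_(i <- s) phi i v *: w i) ->
  lftrace f = \sum_(i <- s) phi i (w i).
Proof.
move=> fE; rewrite /lftrace.
under eq_bigr => k _ do rewrite fE linear_sum.
rewrite exchange_big; apply: eq_bigr => i _.
rewrite [in RHS](coord_fullv (w i)) linear_sum; apply: eq_bigr => k _.
by rewrite !linearZ /= /GRing.scale /= mulrC.
Qed.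

End Trace.

Section Span.
Variables (K : fieldType) (V W : vectType K).

Lemma linear_span0 (L : V -> W) (s : seq V) :
  linear L -> (forall x, x \in s -> L x = 0) -> forall v, v \in span s -> L v = 0.
Proof.
move=> lL h v vs; rewrite -(linfunE lL); apply/eqP; rewrite -memv_ker.
apply: (subvP _ v vs); apply/span_subvP => x xs.
by rewrite memv_ker linfunE // h.
Qed.

End Span.

Section LieBasics.
Variables (K : fieldType) (g : vectType K) (br : g -> g -> g).
Hypothesis hbr : lie_bracket br.
Local Notation kil := (killing br).

Lemma br_linr x : linear (br x). Proof. by case: hbr. Qed.
Lemma br_linl y : linear (br^~ y). Proof. by case: hbr. Qed.
Lemma adE x y : ad br x y = br x y.
Proof. by rewrite /ad linfunE //; exact: br_linr. Qed.

Lemma brDr x y z : br x (y + z) = br x y + br x z.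
Proof. by rewrite -!adE linearD. Qed.
Lemma brZr c x y : br x (c *: y) = c *: br x y.
Proof. by rewrite -!adE linearZ. Qed.
Lemma brNr x y : br x (- y) = - br x y.
Proof. by rewrite -!adE linearN. Qed.
Lemma br0r x : br x 0 = 0.
Proof. by rewrite -adE linear0. Qed.
Lemma brDl x y z : br (x + y) z = br x z + br y z.
Proof. by have := br_linl z 1 x y; rewrite !scale1r. Qed.
Lemma br0l z : br 0 z = 0.
Proof. by apply: (addrI (br 0 z)); rewrite -brDl !addr0. Qed.
Lemma brZl c x z : br (c *: x) z = c *: br x z.
Proof. by have := br_linl z c x 0; rewrite br0l !addr0. Qed.
Lemma brNl x z : br (- x) z = - br x z.
Proof. by rewrite -scaleN1r brZl scaleN1r. Qed.
Lemma brxx x : br x x = 0. Proof. by case: hbr. Qed.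
Lemma br_anti x y : br x y = - br y x.
Proof.
have := brxx (x + y); rewrite brDl !brDr !brxx add0r addr0 => /eqP.
by rewrite addr_eq0 => /eqP.
Qed.
Lemma br_jacobi x y z : br (br x y) z = br x (br y z) - br y (br x z).
Proof.
have [_ _ _ J] := hbr; have := J x y z.
rewrite (br_anti z x) brNr (br_anti z (br x y)) => /eqP.
by rewrite subr_eq0 => /eqP.
Qed.

Lemma ad_br x y : ad br (br x y) = ((ad br x \o ad br y) - (ad br y \o ad br x))%VF.
Proof.
apply/lfunP => z; rewrite add_lfunE opp_lfunE !comp_lfunE !adE.
exact: br_jacobi.
Qed.

Lemma killingC x y : kil x y = kil y x.
Proof. exact: lftrace_comp. Qed.

Lemma killingDl x y z : kil (x + y) z = kil x z + kil y z.
Proof.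
rewrite /killing -lftraceD; congr lftrace; apply/lfunP => v.
by rewrite add_lfunE !comp_lfunE !adE brDl.
Qed.

Lemma killingZl c x z : kil (c *: x) z = c * kil x z.
Proof.
rewrite /killing -lftraceZ; congr lftrace; apply/lfunP => v.
by rewrite scale_lfunE !comp_lfunE !adE brZl.
Qed.

Lemma killingDr x y z : kil z (x + y) = kil z x + kil z y.
Proof. by rewrite killingC killingDl !(killingC z). Qed.
Lemma killingZr c x z : kil z (c *: x) = c * kil z x.
Proof. by rewrite killingC killingZl (killingC z). Qed.
Lemma killingNr x z : kil z (- x) = - kil z x.
Proof. by rewrite -scaleN1r killingZr mulN1r. Qed.
Lemma killing_lin x : linear (kil x : g -> K^o).
Proof. by move=> c u v; rewrite killingDr killingZr. Qed.

Lemma killing_inv x y z : kil (br x y) z = kil x (br y z).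
Proof.
rewrite /killing !ad_br.
have N (f : 'End(g)) : lftrace (- f) = - lftrace f.
  by rewrite -scaleN1r lftraceZ mulN1r.
rewrite comp_lfunDl comp_lfunNl lftraceD N comp_lfunDr comp_lfunNr lftraceD N.
rewrite !comp_lfunA; congr (_ - _).
by rewrite -comp_lfunA lftrace_comp.
Qed.

(** Invariance of the Killing form makes ad H skew. *)
Lemma killing_weight H x y a c : br H x = a *: x -> br H y = c *: y ->
  (a + c) * kil x y = 0.
Proof.
move=> hx hy; rewrite mulrDl -killingZl -killingZr -hx -hy.
by rewrite (br_anti H x) -scaleN1r killingZl killing_inv mulN1r addNr.
Qed.

Lemma memv_brv (U V : {vspace g}) x y : x \in U -> y \in V -> br x y \in brv br U V.
Proof.
move=> xU yV; rewrite (coord_vbasis xU) (coord_vbasis yV).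
have brsl (I : Type) (s : seq I) (u : I -> g) z :
    br (\sum_(i <- s) u i) z = \sum_(i <- s) br (u i) z.
  by elim/big_rec2: _ => [|i a c _ <-]; rewrite ?br0l ?brDl.
have brsr (I : Type) (s : seq I) (u : I -> g) z :
    br z (\sum_(i <- s) u i) = \sum_(i <- s) br z (u i).
  by elim/big_rec2: _ => [|i a c _ <-]; rewrite ?br0r ?brDr.
rewrite brsl; apply: memv_suml => i _; rewrite brsr; apply: memv_suml => j _.
rewrite brZl brZr; do 2 apply: memvZ; apply: memv_span; apply/allpairsP.
exists ((vbasis U)`_i, (vbasis V)`_j); split => //=; apply: mem_nth; rewrite size_tuple //.
Qed.

End LieBasics.


(** * Root decomposition and reality of the root pairings *)

Section FlagLie.
Variables (R : realType) (d : nat) (F : flag_datum R d).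
Local Notation g := (lie F).
Local Notation h := (cartan F).
Local Notation dual := ('Hom(subvs_of (cartan F), R[i]^o)).
Local Notation bra := (@br _ _ F).
Local Notation kil := (killing (@br _ _ F)).
Local Notation X := (@Xr _ _ F).
Let L := br_lie F.

(** Roots are only defined on the Cartan subalgebra; composing with the
    projection gives a total linear form. *)
Definition wt (al : dual) (x : g) : R[i] := al (vsproj h x).

Lemma wt_lin al : linear (wt al : g -> R[i]^o).
Proof. by move=> c x y; rewrite /wt !linearP. Qed.

HB.instance Definition _ al := GRing.isLinear.Build R[i] g R[i]^o _ (wt al) (wt_lin al).

Lemma wtX al x : al \in roots F -> x \in h -> bra x (X al) = wt al x *: X al.
Proof. by move=> ra xh; have := Xr_in ra (vsproj h x); rewrite vsprojK. Qed.

Lemma wtHr al x : al \in roots F -> x \in h -> kil (Hr al) x = wt al x.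
Proof. by move=> ra xh; rewrite /wt (HrP ra) vsprojK. Qed.

Lemma wtD al be x : wt (al + be) x = wt al x + wt be x.
Proof. by rewrite /wt add_lfunE. Qed.
Lemma wtN al x : wt (- al) x = - wt al x.
Proof. by rewrite /wt opp_lfunE. Qed.

Lemma wt_ext (al be : dual) : (forall x, x \in h -> wt al x = wt be x) -> al = be.
Proof.
move=> e; apply/lfunP => v; have := e (vsval v) (subvsP v).
by rewrite /wt vsvalK.
Qed.

Lemma wt_neq0 (al : dual) : al != 0 -> exists2 x, x \in h & wt al x != 0.
Proof.
move=> a0; apply: contrapT => hn; move/eqP: a0; apply; apply: wt_ext => x xh.
apply/eqP; rewrite /wt zero_lfunE; apply/negPn/negP => w0; apply: hn.
by exists x.
Qed.

Lemma root_neq0 al : al \in roots F -> al != 0.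
Proof. by move/rootsP => []. Qed.

(** The simple roots span the dual of the Cartan subalgebra, hence so do all
    roots. *)
Lemma wt_sep x : x \in h -> (forall al, al \in roots F -> wt al x = 0) -> x = 0.
Proof.
move=> xh hx; rewrite -(vsprojK xh); set v := vsproj h x.
suff -> : v = 0 by rewrite linear0.
rewrite (coord_fullv v) big1 // => i _; rewrite [coord _ _ _](_ : _ = 0) ?scale0r //.
have li : linear (coord (vbasis {:subvs_of h}) i : subvs_of h -> R[i]^o).
  by move=> c u w; rewrite linearP.
pose phi : dual := linfun (coord (vbasis {:subvs_of h}) i : subvs_of h -> R[i]^o).
rewrite -[LHS](linfunE li v) -/phi.
have /andP[/eqP sp _] := simple_basis F.
have : phi \in span (simple F) by rewrite sp memvf.
move=> /(@coord_span _ _ _ (in_tuple (simple F)) _) ->.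
rewrite sum_lfunE big1 // => j _; rewrite scale_lfunE.
have -> : (in_tuple (simple F))`_j v = 0; last by rewrite scaler0.
apply: hx; apply: (@simple_sub _ _ F); exact: mem_nth.
Qed.

Lemma cartan_br x y : x \in h -> y \in h -> bra x y \in h.
Proof.
move=> xh yh; have [hh _ _] := cartanP F; apply: (subvP hh); exact: memv_brv.
Qed.

Lemma X_neq0 al : al \in roots F -> X al != 0.
Proof.
move=> ra; apply/eqP => e; have := Xr_killing ra; rewrite e.
rewrite -(scale0r (0 : g)) (killingZl L) mul0r => /eqP.
by rewrite eq_sym oner_eq0.
Qed.

(** By the Jacobi identity [x, y] acts by 0 on each X al, so all roots vanish on
    it. *)
Lemma cartan_abelian x y : x \in h -> y \in h -> bra x y = 0.
Proof.
move=> xh yh; apply: wt_sep; first exact: cartan_br.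
move=> al ra; have : bra (bra x y) (X al) = 0.
  rewrite (br_jacobi L) (wtX ra yh) (wtX ra xh) !(brZr L) (wtX ra yh) (wtX ra xh).
  by rewrite !scalerA mulrC subrr.
rewrite (wtX ra (cartan_br xh yh)) => /eqP; rewrite scaler_eq0 (negbTE (X_neq0 ra)) orbF.
by move/eqP.
Qed.

Lemma lin_vanish (W : vectType R[i]) (phi : g -> W) : linear phi ->
  (forall x, x \in h -> phi x = 0) ->
  (forall al, al \in roots F -> phi (X al) = 0) -> forall v, phi v = 0.
Proof.
move=> lp ph pX v; rewrite -(linfunE lp); apply/eqP; rewrite -memv_ker.
apply: (subvP _ v (memvf v)); rewrite -(Xr_span F) subv_add; apply/andP; split.
  by apply/subvP => x xh; rewrite memv_ker linfunE // ph.
by apply/span_subvP => _ /mapP[al ra ->]; rewrite memv_ker linfunE // pX.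
Qed.

Lemma killing_X_cartan al x : al \in roots F -> x \in h -> kil (X al) x = 0.
Proof.
move=> ra xh; have [H Hh w0] := wt_neq0 (root_neq0 ra).
have bx : bra H x = 0 *: x by rewrite scale0r cartan_abelian.
have /eqP := killing_weight L (wtX ra Hh) bx.
by rewrite addr0 mulf_eq0 (negbTE w0) => /eqP.
Qed.

Lemma killing_X_X al be : al \in roots F -> be \in roots F -> al + be != 0 ->
  kil (X al) (X be) = 0.
Proof.
move=> ra rb ab; have [H Hh w0] := wt_neq0 ab.
have /eqP := killing_weight L (wtX ra Hh) (wtX rb Hh).
by rewrite -wtD mulf_eq0 (negbTE w0) => /eqP.
Qed.

(** The Killing form pairs X al to zero with the Cartan subalgebra and with the
    root spaces other than that of - al.  If - al were not a root, X al would be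
    orthogonal to everything, against <X al, X (- al)> = 1. *)
Lemma roots_opp al : al \in roots F -> - al \in roots F.
Proof.
move=> ra; apply/negPn/negP => blk_y.
have : kil (X al) (X (- al)) = 0.
  apply: (@lin_vanish R[i]^o (kil (X al))); first exact: killing_lin.
    by move=> x xh; exact: killing_X_cartan.
  move=> be rb; apply: killing_X_X => //; apply: contra blk_y => /eqP e.
  suff <- : be = - al by [].
  by apply/eqP; rewrite -addr_eq0 addrC e.
by rewrite Xr_killing // => /eqP; rewrite oner_eq0.
Qed.

Lemma roots_neg al : (- al \in roots F) = (al \in roots F).
Proof. by apply/idP/idP => /roots_opp; rewrite ?opprK. Qed.

Lemma killing_XN al be : al \in roots F -> be \in roots F ->
  kil (X (- al)) (X be) = (al == be)%:R.
Proof.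
move=> ra rb; have [<-|ab] := eqVneq al be.
  by rewrite (killingC _) Xr_killing.
by apply: killing_X_X; rewrite ?roots_neg // addrC subr_eq0 eq_sym.
Qed.

(** The coefficient of v on X al is <X (- al), v>; this gives the root
    decomposition with explicit coordinates. *)
Lemma cartan_proj v : v - \sum_(al <- roots F) kil (X (- al)) v *: X al \in h.
Proof.
pose P (v : g) := v - \sum_(al <- roots F) kil (X (- al)) v *: X al.
(* Q v = 0 says that P v lies in the Cartan subalgebra *)
pose Q (v : g) := P v - vsval (vsproj h (P v)).
have lP : linear P.
  move=> c u w; rewrite /P scalerBr [RHS]addrACA -opprD scaler_sumr -big_split /=.
  congr (_ - _); apply: eq_bigr => al _.
  by rewrite (killing_lin L) scalerDl scalerA.
have lT : linear (fun u : g => u - vsval (vsproj h u)).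
  by move=> c u w; rewrite !linearP /= scalerBr addrACA scalerN.
have lQ : linear Q by move=> c u w; rewrite /Q lP; exact: lT.
have Ph u : P u \in h -> Q u = 0 by move=> uh; rewrite /Q vsprojK // subrr.
suff : Q v = 0 by move/eqP; rewrite subr_eq0 => /eqP; rewrite /P => ->; exact: subvsP.
apply: lin_vanish => // [x xh|be rb]; apply: Ph; rewrite /P.
  rewrite big_seq big1 ?subr0 // => al ra.
  by rewrite killing_X_cartan ?roots_neg // scale0r.
rewrite (bigD1_seq be) ?roots_uniq //= killing_XN // eqxx scale1r big_seq_cond big1.
  by rewrite addr0 subrr mem0v.
by move=> al /andP[ra ab]; rewrite killing_XN // (negbTE ab) scale0r.
Qed.

(** The bracket commutes with the Cartan subalgebra, hence belongs to it by
    self-normalization, and invariance of the Killing form shows that it has the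
    same Killing products with the Cartan subalgebra as H al. *)
Lemma br_XN al : al \in roots F -> bra (X al) (X (- al)) = Hr al.
Proof.
move=> ra; have rna : - al \in roots F by rewrite roots_neg.
set D := bra _ _.
have Dh : D \in h.
  have [_ _ sn] := cartanP F; apply: sn => y yh.
  rewrite (br_anti L) memvN; suff -> : bra y D = 0 by exact: mem0v.
  have -> : bra y D = bra (bra y (X al)) (X (- al)) + bra (X al) (bra y (X (- al))).
    by rewrite (br_jacobi L) subrK.
  rewrite (wtX ra yh) (wtX rna yh) (brZl L) (brZr L) wtN scaleNr.
  by rewrite subrr.
apply/eqP; rewrite -subr_eq0; apply/eqP.
have Hh := Hr_in ra.
apply: wt_sep => [|be rb]; first exact: memvB.
rewrite -wtHr // ?memvB // (killingDr L) (killingNr L) (killingC _ (Hr be)) killing_inv //.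
rewrite (br_anti L) (wtX rna (Hr_in rb)) (killingNr L) (killingZr L) Xr_killing // mulr1.
by rewrite wtN opprK -(wtHr ra (Hr_in rb)) (killingC _ (Hr al)) subrr.
Qed.

(** The number <H al, H be>.  Its reality is what makes the torus act by
    rotations: al (H) is then purely imaginary for H in i h_R. *)
Definition root_pair (al be : dual) : R[i] := wt be (Hr al).

Lemma root_pairD al be ga : root_pair al (be + ga) = root_pair al be + root_pair al ga.
Proof. exact: wtD. Qed.
Lemma root_pairN al be : root_pair al (- be) = - root_pair al be.
Proof. exact: wtN. Qed.

Lemma opC (r : R) : (- r)%:C = - r%:C.
Proof. exact: rmorphN. Qed.

Definition isreal (z : R[i]) := exists r : R, z = r%:C.
Lemma isrealD z w : isreal z -> isreal w -> isreal (z + w).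
Proof. by move=> [r ->] [s ->]; exists (r + s); rewrite rmorphD. Qed.
Lemma isrealN z : isreal z -> isreal (- z).
Proof. by move=> [r ->]; exists (- r); rewrite rmorphN. Qed.

Lemma br_opp_br al be : al \in roots F -> be \in roots F -> al + be != 0 ->
  exists r : R, bra (X (- al)) (bra (X al) (X be)) = r%:C *: X be
    /\ (al + be \notin roots F -> r = 0).
Proof.
move=> ra rb ab; rewrite Xr_br //.
have [rab|nab] := boolP (al + be \in roots F); last first.
  by exists 0; rewrite mr_notin // !scale0r (br0r L).
have rna : - al \in roots F by rewrite roots_neg.
rewrite (brZr L) (Xr_br rna rab); last by rewrite addKr root_neq0.
by rewrite addKr scalerA -rmorphM; eexists; split.
Qed.

(** Expand [H al, X be] = [[X al, X (- al)], X be] by the Jacobi identity: both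
    terms are products of structure constants, which are real. *)
Lemma root_pair_jacobi al be : al \in roots F -> be \in roots F ->
  be != al -> be != - al -> exists r s : R,
  [/\ root_pair al be = (r - s)%:C, be + al \notin roots F -> s = 0
    & be - al \notin roots F -> r = 0].
Proof.
move=> ra rb n1 n2; have rna : - al \in roots F by rewrite roots_neg.
have [|||s [es s0]] := @br_opp_br al be => //.
  rewrite addrC addr_eq0; exact: n2.
have [|||r [er r0]] := @br_opp_br (- al) be => //.
  rewrite addrC subr_eq0; exact: n1.
rewrite opprK in er.
exists r, s; split; [|by rewrite addrC|by rewrite addrC].
have := wtX rb (Hr_in ra); rewrite -br_XN // (br_jacobi L) er es -scalerBl br_XN //.
rewrite -rmorphB => /eqP; rewrite -subr_eq0 -scalerBl scaler_eq0 (negbTE (X_neq0 rb)) orbF.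
by rewrite subr_eq0 => /eqP ->.
Qed.

Lemma root_pair_real_off al be : al \in roots F -> be \in roots F ->
  be != al -> be != - al -> isreal (root_pair al be).
Proof. by move=> ra rb n1 n2; have [r [s [-> _ _]]] := root_pair_jacobi ra rb n1 n2; eexists. Qed.

Lemma root2_neq al : al \in roots F -> al != - al.
Proof.
move=> ra; apply/eqP => e; have := root_neq0 ra; have : al *+ 2 = 0.
  by rewrite mulr2n {2}e subrr.
by move/eqP; rewrite -scaler_nat scaler_eq0 pnatr_eq0 => /= ->.
Qed.

(** ad x is diagonal in the root decomposition, with eigenvalue 0 on the Cartan
    subalgebra. *)
Lemma killing_cartan x : x \in h -> kil x x = \sum_(al <- roots F) wt al x ^+ 2.
Proof.
move=> xh; rewrite /killing.
rewrite (@lftrace_sum _ _ _ (roots F)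
  (fun al => linfun (fun v : g => (wt al x ^+ 2 * kil (X (- al)) v : R[i]^o))) X).
  rewrite big_seq [RHS]big_seq; apply: eq_bigr => al ra.
  rewrite linfunE.
    by rewrite killing_XN // eqxx mulr1.
  by move=> c u v; rewrite (killing_lin L) mulrDr /GRing.scale /= mulrCA.
move=> v; rewrite comp_lfunE !(adE L).
pose s (v : g) := \sum_(al <- roots F) kil (X (- al)) v *: X al.
pose v0 := v - s v.
have vE : v = v0 + s v by rewrite subrK.
have v0h : v0 \in h by exact: cartan_proj.
have brs (c : dual -> R[i]) : bra x (\sum_(al <- roots F) c al *: X al) =
    \sum_(al <- roots F) (c al * wt al x) *: X al.
  rewrite -(adE L) linear_sum big_seq [RHS]big_seq; apply: eq_bigr => al ra.
  by rewrite linearZ /= (adE L) wtX // scalerA.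
rewrite {1}vE (brDr L) (cartan_abelian xh v0h) add0r /s brs brs.
rewrite big_seq [RHS]big_seq; apply: eq_bigr => al ra.
rewrite linfunE; last first.
  by move=> c u w; rewrite (killing_lin L) mulrDr /GRing.scale /= mulrCA.
congr (_ *: _).
by rewrite -mulrA -expr2 mulrC.
Qed.

(** If be is a root different from al and - al and be + al is a root, then
    <H al, H al> is a difference of real numbers <H al, H (be + al)> and
    <H al, H be>; similarly for be - al, and if be is twice al or its opposite
    then <H al, H al> is half of a real number.  If there is no such be, all the
    other pairings with al vanish by [root_pair_jacobi], and the trace formula
    [killing_cartan] reads z = 2 z^2 for z = <H al, H al>. *)
Lemma root_pair_self_real al : al \in roots F -> isreal (root_pair al al).
Proof.
move=> ra; have rna := roots_opp ra.
have dbl be : be \in roots F -> be = al *+ 2 \/ be = - (al *+ 2) -> isreal (root_pair al al).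
  move=> rb hb.
  have n1 : be != al.
    apply/eqP => e; move: hb; rewrite e mulr2n => -[/eqP|/eqP].
      by rewrite -subr_eq0 opprD addrA subrr sub0r oppr_eq0 (negbTE (root_neq0 ra)).
    rewrite -subr_eq0 opprK addrA -mulr2n -mulrSr -scaler_nat scaler_eq0 pnatr_eq0 /=.
    by rewrite (negbTE (root_neq0 ra)).
  have n2 : be != - al.
    apply/eqP => e; move: hb; rewrite e mulr2n => -[/eqP|/eqP].
      rewrite eq_sym -subr_eq0 opprK -mulr2n -mulrSr -scaler_nat scaler_eq0 pnatr_eq0 /=.
      by rewrite (negbTE (root_neq0 ra)).
    rewrite eqr_opp -subr_eq0 opprD addrA subrr sub0r oppr_eq0.
    by rewrite (negbTE (root_neq0 ra)).
  have [r e] := root_pair_real_off ra rb n1 n2.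
  have e2 : root_pair al al *+ 2 = r%:C \/ root_pair al al *+ 2 = (- r)%:C.
    by case: hb => hb; [left|right]; rewrite ?opC -e hb ?root_pairN !mulr2n root_pairD ?opprK.
  exists (complex.Re (root_pair al al)); move: e2; case: (root_pair al al) => a b.
  by rewrite mulr2n => -[] [_] /eqP; rewrite -mulr2n mulrn_eq0 /= => /eqP ->.
have [[be [rb n1 n2 hb]]|hn] := pselect (exists be, [/\ be \in roots F, be != al, be != - al
    & (be + al \in roots F) || (be - al \in roots F)]).
  have rab := root_pair_real_off ra rb n1 n2.
  have [e|n2'] := eqVneq be (al *+ 2); first by apply: (dbl be) => //; left.
  have [e|n1'] := eqVneq be (- (al *+ 2)); first by apply: (dbl be) => //; right.
  case/orP: hb => rc.
    have : isreal (root_pair al (be + al)).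
      apply: root_pair_real_off => //.
        by rewrite -subr_eq0 addrK root_neq0.
      rewrite -subr_eq0 opprK -addrA -mulr2n addr_eq0; exact: n1'.
    by rewrite root_pairD => h1; have := isrealD h1 (isrealN rab); rewrite addrC addrA addNr add0r.
  have : isreal (root_pair al (be - al)).
    apply: root_pair_real_off => //.
      rewrite -subr_eq0 -addrA -opprD -mulr2n subr_eq0; exact: n2'.
    by rewrite -subr_eq0 opprK subrK root_neq0.
  rewrite root_pairD root_pairN => h1; have := isrealN (isrealD h1 (isrealN rab)).
  by rewrite [_ - root_pair al al]addrC addrK opprK.
have z0 be : be \in roots F -> be != al -> be != - al -> root_pair al be = 0.
  move=> rb n1 n2; have [r [s [-> s0 r0]]] := root_pair_jacobi ra rb n1 n2.
  rewrite s0 ?r0 ?subrr //; apply/negP => hh; apply: hn; exists be; split=> //;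
    by rewrite hh ?orbT.
have e : root_pair al al = root_pair al al ^+ 2 *+ 2.
  have := killing_cartan (Hr_in ra); rewrite (wtHr ra (Hr_in ra)) -/(root_pair al al) => {1}->.
  rewrite (bigD1_seq al) ?roots_uniq //= big_mkcond (bigD1_seq (- al)) ?roots_uniq //=.
  rewrite eq_sym root2_neq // wtN sqrrN addrA -mulr2n -/(root_pair al al).
  rewrite big_seq_cond big1 ?addr0 // => be /andP[rb n2]; case: ifP => // n1.
  by rewrite -/(root_pair al be) z0 // expr0n.
have : root_pair al al * (root_pair al al *+ 2 - 1) = 0.
  by rewrite mulrBr mulr1 mulrnAr -expr2 -e subrr.
move/eqP; rewrite mulf_eq0 => /orP[/eqP->|]; first by exists 0.
rewrite subr_eq0 => /eqP e1; exists (complex.Re (root_pair al al)); move: e1.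
case: (root_pair al al) => a b; rewrite mulr2n => -[_] /eqP.
by rewrite -mulr2n mulrn_eq0 /= => /eqP ->.
Qed.

Lemma root_pair_real al be : al \in roots F -> be \in roots F -> isreal (root_pair al be).
Proof.
move=> ra rb; have [->|n1] := eqVneq be al; first exact: root_pair_self_real.
have [->|n2] := eqVneq be (- al).
  by rewrite root_pairN; apply: isrealN; exact: root_pair_self_real.
exact: root_pair_real_off.
Qed.

End FlagLie.

(** * Exponential of an infinitesimal rotation *)

Section Exponential.
Variables (R : realType) (W : vectType R) (I : finType).

Lemma cvgn_sum (s : seq I) (t : I -> nat -> R) (l : I -> R) :
  (forall i, t i n @[n --> \oo] --> l i) ->
  \sum_(i <- s) t i n @[n --> \oo] --> \sum_(i <- s) l i.
Proof.
move=> ht; elim: s => [|i s IH].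
  by under eq_fun do rewrite big_nil; rewrite big_nil; exact: cvg_cst.
under eq_fun do rewrite big_cons.
by rewrite big_cons; apply: cvgD.
Qed.

Lemma lfexp_cvg (f : W -> W) v (A S : I -> W) (t u : I -> nat -> R) (l m : I -> R) :
  (forall n, \sum_(k < n) k`!%:R^-1 *: iter k f v =
             \sum_i (t i n *: A i + u i n *: S i)) ->
  (forall i, t i n @[n --> \oo] --> l i) -> (forall i, u i n @[n --> \oo] --> m i) ->
  lfexp f v = \sum_i (l i *: A i + m i *: S i).
Proof.
move=> hs ht hu; rewrite [RHS](coord_fullv _) /lfexp; apply: eq_bigr => k _.
congr (_ *: _); apply: cvg_lim => //.
under eq_fun do rewrite hs linear_sum.
rewrite linear_sum; apply: cvgn_sum => i.
under eq_fun do rewrite linearD !linearZ.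
rewrite linearD !linearZ; apply: cvgD; apply: cvgMl; [exact: ht|exact: hu].
Qed.

Variables (f : W -> W) (A S : I -> W) (th : I -> R).
Hypothesis lf : linear f.
Hypothesis fA : forall i, f (A i) = th i *: S i.
Hypothesis fS : forall i, f (S i) = - th i *: A i.

Let c i k : R := (~~ odd k)%:R * (-1) ^+ k./2 * th i ^+ k.
Let s i k : R := (odd k)%:R * (-1) ^+ k.-1./2 * th i ^+ k.

Lemma iter_rot k a b : iter k f (\sum_i (a i *: A i + b i *: S i)) =
  \sum_i ((a i * c i k - b i * s i k) *: A i + (a i * s i k + b i * c i k) *: S i).
Proof.
have fsum (a' b' : I -> R) : f (\sum_i (a' i *: A i + b' i *: S i)) =
    \sum_i ((- (b' i * th i)) *: A i + (a' i * th i) *: S i).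
  rewrite -(linfunE lf) linear_sum; apply: eq_bigr => i _.
  transitivity (a' i *: f (A i) + b' i *: f (S i)).
    by rewrite linearD !linearZ /= !linfunE.
  by rewrite fA fS scaleNr scalerN !scalerA addrC -scaleNr.
elim: k => [|k IH].
  apply: eq_bigr => i _; rewrite /c /s /= !expr0.
  by congr (_ *: _ + _ *: _); ring.
rewrite iterS IH fsum; apply: eq_bigr => i _.
have cS : c i k.+1 = - (s i k * th i).
  rewrite /c /s /= negbK exprSr; case: (boolP (odd k)) => ko; last by rewrite !mul0r oppr0.
  have -> : uphalf k = (k.-1./2).+1.
    by case: k ko {IH} => // k ko; rewrite /= uphalf_half; case: (odd k) ko.
  by rewrite exprS; ring.
have sS : s i k.+1 = c i k * th i.
  by rewrite /c /s /= exprSr; ring.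
by rewrite cS sS; congr (_ *: _ + _ *: _); ring.
Qed.

(** The even and odd iterates of an infinitesimal rotation give the series of
    cos and sin. *)
Lemma lfexp_rot a b : lfexp f (\sum_i (a i *: A i + b i *: S i)) =
  \sum_i ((a i * cos (th i) - b i * sin (th i)) *: A i
          + (a i * sin (th i) + b i * cos (th i)) *: S i).
Proof.
have cE i k : k`!%:R^-1 * c i k = cos_coeff (th i) k.
  by rewrite /c /cos_coeff /= mulrC.
have sE i k : k`!%:R^-1 * s i k = sin_coeff (th i) k.
  by rewrite /s /sin_coeff /= mulrC.
have hc i : series (cos_coeff (th i)) n @[n --> \oo] --> cos (th i).
  by rewrite unlock; exact: is_cvg_series_cos_coeff.
have hs i : series (sin_coeff (th i)) n @[n --> \oo] --> sin (th i).
  by rewrite unlock; exact: is_cvg_series_sin_coeff.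
apply: (@lfexp_cvg f _ A S
  (fun i n => a i * series (cos_coeff (th i)) n - b i * series (sin_coeff (th i)) n)
  (fun i n => a i * series (sin_coeff (th i)) n + b i * series (cos_coeff (th i)) n)).
- move=> n; under eq_bigr => k _ do rewrite iter_rot scaler_sumr.
  rewrite exchange_big; apply: eq_bigr => i _ /=.
  rewrite /series /= !big_mkord !mulr_sumr -sumrB -big_split /= !scaler_suml -big_split /=.
  apply: eq_bigr => k _; rewrite scalerDr !scalerA -!cE -!sE.
  by congr (_ *: _ + _ *: _); ring.
- by move=> i; apply: cvgB; apply: cvgMr; [exact: hc|exact: hs].
- by move=> i; apply: cvgD; apply: cvgMr; [exact: hs|exact: hc].
Qed.

End Exponential.

(** * The torus and the real coordinates of the root planes *)

Section RealForm.
Variables (R : realType) (d : nat) (F : flag_datum R d).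
Local Notation g := (lie F).
Local Notation gR := (realif (lie F)).
Local Notation h := (cartan F).
Local Notation bra := (@br _ _ F).
Local Notation kil := (killing (@br _ _ F)).
Local Notation X := (@Xr _ _ F).
Local Notation A := (wA F).
Local Notation S := (wS F).
Local Notation tor := (@Defs.tor _ _ F).
Let L := br_lie F.

Lemma Re_lin (phi : g -> R[i]^o) : linear phi ->
  linear (fun v : gR => complex.Re (phi (v : g)) : R^o).
Proof.
move=> lp a u v; have := lp a%:C u v; rewrite -/(a *: (u : gR)) => ->.
by case: (phi u) (phi v) => x y [x' y']; rewrite /GRing.scale /= mul0r subr0.
Qed.

Lemma Im_lin (phi : g -> R[i]^o) : linear phi ->
  linear (fun v : gR => complex.Im (phi (v : g)) : R^o).
Proof.
move=> lp a u v; have := lp a%:C u v; rewrite -/(a *: (u : gR)) => ->.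
by case: (phi u) (phi v) => x y [x' y']; rewrite /GRing.scale /= mul0r addr0.
Qed.

Definition proot j := tnth (pos F) j.

Lemma proot_pos j : proot j \in pos F. Proof. exact: mem_tnth. Qed.
Lemma proot_root j : proot j \in roots F. Proof. by have /posP[] := proot_pos j. Qed.
Lemma nproot_root j : - proot j \in roots F. Proof. by rewrite roots_neg proot_root. Qed.

Lemma proot_inj : injective proot.
Proof. by move=> j k; apply/tuple_uniqP; exact: pos_uniq. Qed.

(** A sum of two positive roots has nonnegative coordinates on the simple roots,
    so it vanishes only if both roots do. *)
Lemma proot_add_neq0 j k : proot j + proot k != 0.
Proof.
have /posP[rj [n en]] := proot_pos j; have /posP[_ [m em]] := proot_pos k.
apply/eqP => e0; move/eqP: (root_neq0 rj); apply.
have : \sum_(i < size (simple F)) (n i + m i)%:R *: (simple F)`_i = 0.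
  rewrite -[RHS]e0 en em -big_split /=; apply: eq_bigr => i _.
  by rewrite natrD scalerDl.
have /andP[_ fr] := simple_basis F.
move/(@freeP _ _ _ (in_tuple (simple F))) : fr => /(_ (fun i => (n i + m i)%:R)) fr /fr z.
rewrite en big1 // => i _; have /eqP := z i.
by rewrite pnatr_eq0 addn_eq0 => /andP[/eqP -> _]; rewrite scale0r.
Qed.

Lemma imul_lin : linear (fun v : gR => ('i *: (v : g) : gR)).
Proof.
move=> a v w; rewrite -[RHS]/(a%:C *: ('i *: (v : g)) + 'i *: (w : g)).
by rewrite scalerA mulrC -scalerA -scalerDr.
Qed.

(** H is i times a real combination of the H be, on which al takes real
    values. *)
Lemma torP H : tor H -> (H : g) \in h /\
  forall al, al \in roots F -> complex.Re (wt al (H : g)) = 0.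
Proof.
rewrite /Defs.tor /= /iRspan => /memv_imgP[u us ->].
rewrite (linfunE imul_lin).
have uh : (u : g) \in h.
  have lT : linear (fun u : gR => ((u : g) - vsval (vsproj h (u : g)) : gR)).
    move=> a v w; rewrite -[RHS]/(a%:C *: ((v : g) - vsval (vsproj h (v : g)))
       + ((w : g) - vsval (vsproj h (w : g)))).
    by rewrite -[a *: v + w]/(a%:C *: (v : g) + (w : g)) !linearP /= scalerBr addrACA scalerN.
  have := linear_span0 lT _ us => /(_ _)/eqP; rewrite subr_eq0 => e.
  rewrite (eqP (e _)); first exact: subvsP.
  by move=> _ /mapP[al ra ->]; rewrite vsprojK ?subrr // Hr_in.
split; first exact: memvZ.
move=> al ra; rewrite linearZ /=.
suff : complex.Im (wt al (u : g)) = 0.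
  rewrite -complexiE; case: (wt al (u : g)) => x y /= ->.
  by rewrite mul0r mulr0 subr0.
apply: (linear_span0 (Im_lin (@wt_lin _ _ F al)) _ us) => _ /mapP[be rb ->].
by have [r e] := root_pair_real rb ra; rewrite -/(root_pair be al) e.
Qed.

Lemma tor_opp H : tor H -> tor (- H).
Proof. by rewrite /Defs.tor /= memvN. Qed.

Lemma tor_add H H' : tor H -> tor H' -> tor (H + H').
Proof. by rewrite /Defs.tor /=; exact: memvD. Qed.

Lemma tor_scale a H : tor H -> tor (a *: H).
Proof. by rewrite /Defs.tor /=; exact: memvZ. Qed.

Lemma tor_iH al : al \in roots F -> tor ('i *: Hr al : g).
Proof.
move=> ra; rewrite /Defs.tor /= /iRspan.
rewrite -[('i *: _ : g)](linfunE imul_lin (Hr al)); apply: memv_img; apply: memv_span.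
by apply/mapP; exists al.
Qed.

(** On the torus, al (H) = i theta, which is the angle of the rotation of exp H
    in the plane of al. *)
Definition theta j (H : gR) : R := complex.Im (wt (proot j) (H : g)).

Lemma theta_lin j : linear (theta j : gR -> R^o).
Proof. exact: Im_lin (@wt_lin _ _ F (proot j)). Qed.

Lemma thetaE j H : tor H -> wt (proot j) (H : g) = 'i * (theta j H)%:C.
Proof.
move=> /torP[_ /(_ _ (proot_root j))]; rewrite /theta -complexiE.
by case: (wt _ _) => x y /= ->; congr Complex; rewrite ?mul0r ?mul1r ?mulr0 ?subr0 ?addr0 ?add0r.
Qed.

Lemma br_A j H : tor H -> bra (H : g) (A j) = theta j H *: S j :> gR.
Proof.
move=> tH; have [Hh _] := torP tH.
rewrite /wA (brDr L) (brNr L) (wtX (proot_root j) Hh) (wtX (nproot_root j) Hh) wtN.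
rewrite scaleNr opprK -scalerDr (thetaE _ tH) mulrC -scalerA.
by [].
Qed.

Lemma br_S j H : tor H -> bra (H : g) (S j) = - theta j H *: A j :> gR.
Proof.
move=> tH; have [Hh _] := torP tH.
rewrite /wS (brZr L) (brDr L) (wtX (proot_root j) Hh) (wtX (nproot_root j) Hh) wtN.
rewrite scaleNr -scalerBr (thetaE _ tH) scalerA mulrA -expr2 sqrCi mulN1r.
by rewrite -[RHS]/((- theta j H)%:C *: (X (proot j) - X (- proot j))) opC.
Qed.

(** On v = z X al - conj(z) X (- al) with z = a + i b, the Killing product with
    X (- al) is z, and v = a A al + b S al. *)
Definition coefA j (v : gR) : R := complex.Re (kil (X (- proot j)) (v : g)).
Definition coefS j (v : gR) : R := complex.Im (kil (X (- proot j)) (v : g)).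

Lemma coefA_lin j : linear (coefA j : gR -> R^o).
Proof. exact: Re_lin (killing_lin L (X (- proot j))). Qed.
Lemma coefS_lin j : linear (coefS j : gR -> R^o).
Proof. exact: Im_lin (killing_lin L (X (- proot j))). Qed.

HB.instance Definition _ j := GRing.isLinear.Build R gR R^o _ (coefA j) (coefA_lin j).
HB.instance Definition _ j := GRing.isLinear.Build R gR R^o _ (coefS j) (coefS_lin j).

Lemma kil_A j k : kil (X (- proot j)) (A k) = (j == k)%:R.
Proof.
rewrite /wA (killingDr L) (killingNr L) killing_XN ?proot_root //.
rewrite (inj_eq proot_inj) killing_X_X ?nproot_root ?subr0 //.
by rewrite -opprD oppr_eq0 proot_add_neq0.
Qed.

Lemma kil_S j k : kil (X (- proot j)) (S k) = 'i * (j == k)%:R.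
Proof.
rewrite /wS (killingZr L) (killingDr L) killing_XN ?proot_root //.
rewrite (inj_eq proot_inj) killing_X_X ?nproot_root ?addr0 //.
by rewrite -opprD oppr_eq0 proot_add_neq0.
Qed.

Lemma coefA_A j k : coefA j (A k) = (j == k)%:R.
Proof. by rewrite /coefA kil_A; case: (j == k). Qed.
Lemma coefS_A j k : coefS j (A k) = 0.
Proof. by rewrite /coefS kil_A; case: (j == k). Qed.
Lemma coefA_S j k : coefA j (S k) = 0.
Proof. by rewrite /coefA kil_S -complexiE; case: (j == k); rewrite /= ?mulr0 ?mul0r subr0. Qed.
Lemma coefS_S j k : coefS j (S k) = (j == k)%:R.
Proof.
by rewrite /coefS kil_S -complexiE; case: (j == k); rewrite /= ?mulr0 ?mul0r ?mul1r ?add0r.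
Qed.

Lemma theta_iH j al : al \in roots F ->
  (theta j ('i *: Hr al : g))%:C = root_pair al (proot j).
Proof.
move=> ra; have [r e] := root_pair_real ra (proot_root j).
rewrite /theta linearZ /= -/(root_pair al (proot j)) e -complexiE /=.
by rewrite mul0r mul1r add0r.
Qed.

(** If f (H al) = <D, H al> = al (D) vanishes for each root al, then D = 0. *)
Lemma root_pair_sep (f : 'Hom(subvs_of h, R[i]^o)) (D : g) : D \in h ->
  (forall x, x \in h -> wt f x = kil D x) -> f != 0 ->
  exists2 al, al \in roots F & wt f (Hr al) != 0.
Proof.
move=> Dh fD f0; apply: contrapT => hn; move/eqP: f0; apply; apply: wt_ext => x xh.
rewrite [RHS]zero_lfunE fD //.
suff -> : D = 0 by rewrite -(scale0r (0 : g)) (killingZl L) mul0r.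
apply: wt_sep => // al ra; rewrite -wtHr // (killingC _) -fD ?Hr_in //.
by apply/eqP/negPn/negP => w0; apply: hn; exists al.
Qed.

(** The difference and the sum of two positive roots are nonzero; take H1 on
    which the difference does not vanish and H2 on which the sum does not.  One
    of H1, H2 and H1 + H2 works. *)
Lemma theta_sep j k : j != k -> exists2 H, tor H &
  theta j H != theta k H /\ theta j H != - theta k H.
Proof.
move=> jk.
have [al ra a0] : exists2 al, al \in roots F & wt (proot j - proot k) (Hr al) != 0.
  apply: (@root_pair_sep _ (Hr (proot j) - Hr (proot k))).
  - by rewrite memvB ?Hr_in ?proot_root.
  - move=> x xh; rewrite wtD wtN (killingC _) (killingDr L) (killingNr L) !(killingC _ x).
    by rewrite !wtHr ?proot_root.
  - by rewrite subr_eq0 (inj_eq proot_inj).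
have [be rb b0] : exists2 al, al \in roots F & wt (proot j + proot k) (Hr al) != 0.
  apply: (@root_pair_sep _ (Hr (proot j) + Hr (proot k))).
  - by rewrite memvD ?Hr_in ?proot_root.
  - by move=> x xh; rewrite wtD (killingDl L) !wtHr ?proot_root.
  - exact: proot_add_neq0.
pose H1 : gR := ('i *: Hr al : g); pose H2 : gR := ('i *: Hr be : g).
have inC (x y : R) : x%:C = y%:C -> x = y by case.
have h1 : theta j H1 - theta k H1 != 0.
  apply: contra a0 => /eqP e; rewrite wtD wtN -!/(root_pair al _) -!theta_iH //.
  by rewrite -rmorphB e.
have h2 : theta j H2 + theta k H2 != 0.
  apply: contra b0 => /eqP e; rewrite wtD -!/(root_pair be _) -!theta_iH //.
  by rewrite -rmorphD e.
have t1 : tor H1 by exact: tor_iH.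
have t2 : tor H2 by exact: tor_iH.
have thD i : theta i (H1 + H2) = theta i H1 + theta i H2.
  by have := theta_lin i 1 H1 H2; rewrite !scale1r.
have [e1|n1] := eqVneq (theta j H1 + theta k H1) 0; last first.
  by exists H1 => //; rewrite -subr_eq0 h1 -addr_eq0 n1.
have [e2|n2] := eqVneq (theta j H2 - theta k H2) 0; last first.
  by exists H2 => //; rewrite -subr_eq0 n2 -addr_eq0 h2.
exists (H1 + H2); first exact: tor_add.
rewrite !thD; split.
  by rewrite -subr_eq0 opprD addrACA e2 addr0.
by rewrite -addr_eq0 addrACA e1 add0r.
Qed.

Lemma theta_nz j : exists2 H, tor H & theta j H != 0.
Proof.
have [al ra a0] : exists2 al, al \in roots F & wt (proot j) (Hr al) != 0.
  apply: (@root_pair_sep _ (Hr (proot j))); rewrite ?Hr_in ?root_neq0 ?proot_root //.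
  by move=> x xh; rewrite wtHr ?proot_root.
exists ('i *: Hr al : g); first exact: tor_iH.
by apply: contra a0 => /eqP e; rewrite -/(root_pair al _) -theta_iH // e.
Qed.

Lemma scale_small (x y : R) : exists2 c : R, 0 < c & `|c * x| <= 1 /\ `|c * y| <= 1.
Proof.
have p : 0 < 1 + `|x| + `|y| by rewrite ltr_wpDr // ltr_wpDr.
exists (1 + `|x| + `|y|)^-1; first by rewrite invr_gt0.
rewrite !normrM gtr0_norm ?invr_gt0 // ![_^-1 * _]mulrC !ler_pdivrMr // !mul1r.
by split; rewrite ?lerDr ?addr_ge0 // addrAC lerDr addr_ge0.
Qed.

Lemma theta_scale j a H : theta j (a *: H) = a * theta j H.
Proof. by have := theta_lin j a H 0; rewrite addr0 => ->; rewrite /theta linear0 addr0. Qed.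

(** Rescale H so that both angles lie in the interval where cos is
    injective. *)
Lemma cos_sep j k : j != k -> exists2 H, tor H & cos (theta j H) != cos (theta k H).
Proof.
move=> jk; have [H tH [n1 n2]] := theta_sep jk.
have [c c0 [s1 s2]] := scale_small (theta j H) (theta k H).
exists (c *: H); first exact: tor_scale.
rewrite !theta_scale.
have pi1 (x : R) : `|x| <= 1 -> `|x| \in `[0, pi].
  move=> x1; rewrite in_itv /= normr_ge0 /= (le_trans x1) //.
  by have := pi_ge2 R; lra.
rewrite -cos_norm -[cos (c * theta k H)]cos_norm.
apply/eqP => /cos_inj; rewrite !pi1 // => /(_ isT isT) /eqP.
rewrite eqr_norm2 -mulrN => /orP[]/eqP /(mulfI (lt0r_neq0 c0)) /eqP.
  by rewrite (negbTE n1).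
by rewrite (negbTE n2).
Qed.

Lemma sin_nz j : exists2 H, tor H & sin (theta j H) != 0.
Proof.
have [H tH n1] := theta_nz j.
have [c c0 [s1 _]] := scale_small (theta j H) 0.
exists (c *: H); first exact: tor_scale.
rewrite theta_scale.
have x0 : 0 < `|c * theta j H| by rewrite normr_gt0 mulf_neq0 // lt0r_neq0.
have : 0 < sin `|c * theta j H|.
  apply: sin_gt0_pi; rewrite x0 /= (le_lt_trans s1) //.
  by have := pi_ge2 R; lra.
case: (ger0P (c * theta j H)) => _; first by move=> h; rewrite lt0r_neq0.
by rewrite sinN oppr_gt0 => h; rewrite ltr0_neq0.
Qed.

End RealForm.

(** * Rotation frames of the tangent space and of a root plane *)

Section SubFrame.
Variables (R : realType) (d : nat) (F : flag_datum R d).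
Local Notation g := (lie F).
Local Notation gR := (realif (lie F)).
Local Notation bra := (@br _ _ F).
Local Notation A := (wA F).
Local Notation S := (wS F).
Local Notation tor := (@Defs.tor _ _ F).
Variables (U : {vspace gR}) (I : finType) (e : I -> 'I_d).
Hypothesis e_inj : injective e.
Hypothesis AU : forall i, A (e i) \in U.
Hypothesis SU : forall i, S (e i) \in U.
Hypothesis spanU : forall v, v \in U ->
  v = \sum_i (coefA (e i) v *: A (e i) + coefS (e i) v *: S (e i)).

Definition sA i : subvs_of U := vsproj U (A (e i)).
Definition sS i : subvs_of U := vsproj U (S (e i)).
Definition scA i : 'Hom(subvs_of U, R^o) := linfun (fun v => coefA (e i) (vsval v) : R^o).
Definition scS i : 'Hom(subvs_of U, R^o) := linfun (fun v => coefS (e i) (vsval v) : R^o).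

Lemma scAE i v : scA i v = coefA (e i) (vsval v).
Proof. by rewrite /scA linfunE // => a u w; rewrite !linearP. Qed.
Lemma scSE i v : scS i v = coefS (e i) (vsval v).
Proof. by rewrite /scS linfunE // => a u w; rewrite !linearP. Qed.
Lemma sAK i : vsval (sA i) = A (e i). Proof. by rewrite vsprojK ?AU. Qed.
Lemma sSK i : vsval (sS i) = S (e i). Proof. by rewrite vsprojK ?SU. Qed.

Lemma lfexp_sub H (v : subvs_of U) : tor H ->
  lfexp (bra (H : g) : gR -> gR) (vsval v) = \sum_i
   ((scA i v * cos (theta (e i) H) - scS i v * sin (theta (e i) H)) *: A (e i)
   + (scA i v * sin (theta (e i) H) + scS i v * cos (theta (e i) H)) *: S (e i)).
Proof.
move=> tH; rewrite {1}(spanU (subvsP v)).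
rewrite (@lfexp_rot _ _ _ _ _ _ (fun i => theta (e i) H)).
- by apply: eq_bigr => i _; rewrite scAE scSE.
- by move=> a u w; exact: (br_linr (br_lie F) (H : g) a%:C u w).
- by move=> i; exact: br_A.
- by move=> i; exact: br_S.
Qed.

Lemma AdTE H (v : subvs_of U) : tor H -> AdT U H v = \sum_i
   ((scA i v * cos (theta (e i) H) - scS i v * sin (theta (e i) H)) *: sA i
   + (scA i v * sin (theta (e i) H) + scS i v * cos (theta (e i) H)) *: sS i).
Proof.
move=> tH; rewrite /AdT linfunE.
  by rewrite lfexp_sub // linear_sum; apply: eq_bigr => i _; rewrite linearD !linearZ.
move=> a u w; rewrite !lfexp_sub // -linearP; congr vsproj.
rewrite scaler_sumr -big_split; apply: eq_bigr => i _ /=.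
move: (A (e i)) (S (e i)) => P Q; rewrite scalerDr !scalerA addrACA -!scalerDl.
have eA : scA i (a *: u + w) = a * scA i u + scA i w by exact: linearP.
have eS : scS i (a *: u + w) = a * scS i u + scS i w by exact: linearP.
by congr (_ *: _ + _ *: _); rewrite eA eS; ring.
Qed.

Lemma scA_sA i j : scA i (sA j) = (i == j)%:R.
Proof. by rewrite scAE sAK coefA_A (inj_eq e_inj). Qed.
Lemma scA_sS i j : scA i (sS j) = 0.
Proof. by rewrite scAE sSK coefA_S. Qed.
Lemma scS_sA i j : scS i (sA j) = 0.
Proof. by rewrite scSE sAK coefS_A. Qed.
Lemma scS_sS i j : scS i (sS j) = (i == j)%:R.
Proof. by rewrite scSE sSK coefS_S (inj_eq e_inj). Qed.

Lemma sub_span (v : subvs_of U) : v = \sum_i (scA i v *: sA i + scS i v *: sS i).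
Proof.
have lc (a b : R) (u w : subvs_of U) :
    vsval (a *: u + b *: w) = a *: vsval u + b *: vsval w.
  by rewrite linearD !linearZ.
apply: subvs_inj; rewrite linear_sum {1}(spanU (subvsP v)); apply: eq_bigr => i _.
by rewrite -(sAK i) -(sSK i) -!scAE -!scSE; exact/esym/lc.
Qed.

Lemma AdT_sA i H : tor H ->
  AdT U H (sA i) = cos (theta (e i) H) *: sA i + sin (theta (e i) H) *: sS i.
Proof.
move=> tH; rewrite AdTE // (bigD1 i) //= big1 ?addr0.
  by rewrite scA_sA scS_sA eqxx !mul1r !mul0r subr0 addr0.
move=> j ji; rewrite scA_sA scS_sA (negbTE ji) !mul0r subr0 addr0 !scale0r.
exact: addr0.
Qed.

Lemma AdT_sS i H : tor H ->
  AdT U H (sS i) = - sin (theta (e i) H) *: sA i + cos (theta (e i) H) *: sS i.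
Proof.
move=> tH; rewrite AdTE // (bigD1 i) //= big1 ?addr0.
  by rewrite scA_sS scS_sS eqxx !mul1r !mul0r sub0r add0r.
move=> j ji; rewrite scA_sS scS_sS (negbTE ji) !mul0r subr0 addr0 !scale0r.
exact: addr0.
Qed.

Lemma theta_opp j H : theta j (- H) = - theta j (H : gR).
Proof. by rewrite -scaleN1r theta_scale mulN1r. Qed.

(** To be used for U the whole of n^- and for U a single root plane; e selects
    the positive roots whose planes make up U. *)
Definition subframe : rotframe tor (AdT U) I.
Proof.
refine (@Rotframe R (subvs_of U) gR tor (AdT U) I sA sS scA scS scA_sA scA_sS
  scS_sA scS_sS sub_span (fun i => theta (e i)) AdT_sA AdT_sS (@tor_opp _ _ F) _ _ _).
- by move=> i H _; exact: theta_opp.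
- by move=> i j ij; apply: cos_sep; rewrite (inj_eq e_inj).
- by move=> i; exact: sin_nz.
Defined.

End SubFrame.

Section Frames.
Variables (R : realType) (d : nat) (F : flag_datum R d).
Local Notation g := (lie F).
Local Notation gR := (realif (lie F)).
Local Notation A := (wA F).
Local Notation S := (wS F).
Local Notation tor := (@Defs.tor _ _ F).
Local Notation kil := (killing (@br _ _ F)).
Local Notation X := (@Xr _ _ F).
Let L := br_lie F.

Lemma A_uroot j : A j \in uroot F j.
Proof. by apply: memv_span; rewrite inE eqxx. Qed.
Lemma S_uroot j : S j \in uroot F j.
Proof. by apply: memv_span; rewrite !inE eqxx orbT. Qed.

Lemma uroot_nminus j v : v \in uroot F j -> v \in nminus F.
Proof. by apply: subvP; rewrite /nminus (sumv_sup j). Qed.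

Lemma expand_lin (I : finType) (e : I -> 'I_d) : linear (fun v : gR =>
  v - \sum_i (coefA (e i) v *: A (e i) + coefS (e i) v *: S (e i))).
Proof.
move=> a u w; rewrite scalerBr [RHS]addrACA -opprD; congr (_ - _).
rewrite scaler_sumr -big_split; apply: eq_bigr => i _ /=.
rewrite (linearP (coefA (e i))) (linearP (coefS (e i))); move: (A (e i)) (S (e i)) => P Q.
by rewrite scalerDr !scalerA addrACA -!scalerDl.
Qed.

Lemma uroot_span j v : v \in uroot F j ->
  v = \sum_(i < 1) (coefA j v *: A j + coefS j v *: S j).
Proof.
move=> vj; apply/eqP; rewrite -subr_eq0; apply/eqP.
apply: (linear_span0 (expand_lin (fun _ : 'I_1 => j)) _ vj) => x.
rewrite !inE big_ord1 => /orP[]/eqP->.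
  by rewrite coefA_A coefS_A eqxx scale1r scale0r addr0 subrr.
by rewrite coefA_S coefS_S eqxx scale1r scale0r add0r subrr.
Qed.

Lemma coefA_comb k (a b : R) (P Q : gR) : coefA k (a *: P + b *: Q) = a * coefA k P + b * coefA k Q.
Proof. by rewrite linearD !linearZ. Qed.
Lemma coefS_comb k (a b : R) (P Q : gR) : coefS k (a *: P + b *: Q) = a * coefS k P + b * coefS k Q.
Proof. by rewrite linearD !linearZ. Qed.

Lemma uroot_coord j k v : v \in uroot F j -> k != j -> coefA k v = 0 /\ coefS k v = 0.
Proof.
move=> /uroot_span ->; rewrite big_ord1 => kj; rewrite coefA_comb coefS_comb.
by rewrite coefA_A coefA_S coefS_A coefS_S (negbTE kj) !mulr0 addr0.
Qed.

Lemma nminus_span v : v \in nminus F ->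
  v = \sum_j (coefA j v *: A j + coefS j v *: S j).
Proof.
rewrite /nminus => /memv_sumP[u uj ->].
have E : linear (fun v : gR => v - \sum_j (coefA j v *: A j + coefS j v *: S j)) :=
  expand_lin id.
apply/eqP; rewrite -subr_eq0 -(linfunE E) linear_sum /= big1 // => j _.
rewrite (linfunE E); apply/eqP; rewrite subr_eq0 (bigD1 j) //= big1 ?addr0.
  by rewrite {1}(uroot_span (uj j isT)) big_ord1.
move=> k kj; have [-> ->] := uroot_coord (uj j isT) kj.
by rewrite !scale0r addr0.
Qed.

Definition nframe : rotframe tor (AdT (nminus F)) 'I_d :=
  subframe (@inj_id _) (fun j => uroot_nminus (A_uroot j))
    (fun j => uroot_nminus (S_uroot j)) nminus_span.

Lemma const_inj (j : 'I_d) : injective (fun _ : 'I_1 => j).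
Proof. by move=> i k _; rewrite !ord1. Qed.

Definition uframe j : rotframe tor (AdT (uroot F j)) 'I_1 :=
  subframe (@const_inj j) (fun _ => A_uroot j) (fun _ => S_uroot j) (@uroot_span j).

Lemma block_sum_coord (p : 'I_d -> gR) j : (forall i, p i \in uroot F i) ->
  coefA j (\sum_i p i) = coefA j (p j) /\ coefS j (\sum_i p i) = coefS j (p j).
Proof.
move=> mem; split; rewrite linear_sum (bigD1 j) //= big1 ?addr0 // => i ij;
  by have [] := uroot_coord (mem i) (_ : j != i); rewrite // eq_sym.
Qed.

(** The components of v in the root planes sum to v, and the coordinates of
    index k only see the component in the plane of k. *)
Lemma pi_coord j k v : v \in nminus F ->
  coefA k (sumv_pi (nminus F) j v) = (if k == j then coefA k v else 0) /\
  coefS k (sumv_pi (nminus F) j v) = (if k == j then coefS k v else 0).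
Proof.
move=> vn; have mem i : sumv_pi (nminus F) i v \in uroot F i by exact: memv_sum_pi.
have E : \sum_i sumv_pi (nminus F) i v = v by exact: sumv_pi_sum.
have [eA eB] := block_sum_coord j mem; rewrite E in eA eB.
case: eqVneq => [->|kj]; last exact: uroot_coord (mem j) kj.
by rewrite eA eB.
Qed.

Lemma gincl_coord j k p :
  [/\ xA nframe k (gincl p : gen (Na F)) = (if k == j then xA (uframe j) ord0 p else 0),
      xS nframe k (gincl p : gen (Na F)) = (if k == j then xS (uframe j) ord0 p else 0),
      yA nframe k (gincl p : gen (Na F)) = (if k == j then yA (uframe j) ord0 p else 0)
    & yS nframe k (gincl p : gen (Na F)) = (if k == j then yS (uframe j) ord0 p else 0)].
Proof.
have pn : vsval p.1 \in nminus F by apply: uroot_nminus (subvsP _).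
have lp : linear (fun v : Na F => p.2 (vsproj (uroot F j) (sumv_pi (nminus F) j (vsval v)))).
  by move=> a u w; rewrite !linearP.
have Ue w : w \in nminus F -> vsproj (uroot F j) (sumv_pi (nminus F) j w)
    = coefA j w *: eA (uframe j) ord0 + coefS j w *: eS (uframe j) ord0.
  move=> wn; rewrite {1}(uroot_span (memv_sum_pi _ _ _)) big_ord1.
  have [-> ->] := pi_coord j j wn; rewrite eqxx.
  by rewrite linearD !linearZ.
split; rewrite /xA /xS /yA /yS /gincl /=.
- rewrite !scAE /= vsprojK //; case: eqVneq => [->//|kj].
  by case: (uroot_coord (subvsP p.1) kj).
- rewrite !scSE /= vsprojK //; case: eqVneq => [->//|kj].
  by case: (uroot_coord (subvsP p.1) kj).
- rewrite linfunE // sAK; last by move=> i; exact: uroot_nminus (A_uroot _).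
  rewrite (Ue _ (uroot_nminus (A_uroot k))) coefA_A coefS_A scale0r addr0 eq_sym.
  by case: eqVneq => _; rewrite ?scale1r // scale0r linear0.
- rewrite linfunE // sSK; last by move=> i; exact: uroot_nminus (S_uroot _).
  rewrite (Ue _ (uroot_nminus (S_uroot k))) coefA_S coefS_S scale0r add0r eq_sym.
  by case: eqVneq => _; rewrite ?scale1r // scale0r linear0.
Qed.

Lemma gincl_block (J : 'End(gen (Na F))) j (Js : 'End(gen (Ua F j))) n m :
  acts_as nframe J j n -> acts_as (uframe j) Js ord0 m ->
  (forall p, J (gincl p) = gincl (Js p)) -> n = m.
Proof.
move=> aJ aU e.
have e0 : acts_as (uframe j) Js ord0 n.
  move=> p; have := aJ (gincl p); rewrite e.
  have [-> -> -> ->] := gincl_coord j p.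
  by have [-> -> -> ->] := gincl_coord j (Js p); rewrite eqxx.
exact: acts_as_inj e0 aU.
Qed.

Lemma block_gincl (J : 'End(gen (Na F))) j (Js : 'End(gen (Ua F j))) (n : 'I_d -> block R) :
  (forall k, acts_as nframe J k (n k)) -> acts_as (uframe j) Js ord0 (n j) ->
  forall p, J (gincl p) = gincl (Js p).
Proof.
move=> aJ aU p; apply: (gen_ext (f := nframe)) => k.
have [-> -> -> ->] := aJ k (gincl p).
have [-> -> -> ->] := gincl_coord k p.
have [-> -> -> ->] := gincl_coord k (Js p).
have [-> -> -> ->] := aU p.
by case: eqVneq => [->|_]; split; ring.
Qed.

Lemma kks_AS j : kcoef F j * kks (A j) (S j : g) = 1.
Proof.
have rj := proot_root F j.
have K0 : kil (Hreg F : g) (Hr (proot F j)) != 0.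
  have [Hh _] := torP (Hreg_in F).
  by rewrite (killingC _) wtHr // /wt; exact: Hreg_regular.
rewrite /kcoef /kks /wA /wS.
have -> : br (Xr (tnth (pos F) j) - Xr (- tnth (pos F) j))
   ('i *: (Xr (tnth (pos F) j) + Xr (- tnth (pos F) j) : g)) = (2 * 'i) *: Hr (proot F j).
  rewrite (brZr L) (brDl L) (brNl L) !(brDr L) !(brxx L) add0r addr0.
  rewrite (br_anti L (Xr (- _))) opprK -mulr2n br_XN // -scaler_nat scalerA.
  by rewrite mulrC.
have i2 : 2 * 'i != 0 :> R[i] by rewrite mulf_neq0 ?pnatr_eq0 ?neq0Ci.
by rewrite (killingZr L) mulVf // mulf_neq0.
Qed.

(** k_al is chosen so that k_al <H, [A, S]> = 1, because [A, S] = 2 i H al. *)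
Lemma starE j : star j (A j : g) = cS (uframe j) ord0 /\
  - star j (S j : g) = cA (uframe j) ord0.
Proof.
have lk (Y : g) : linear (fun Z : Ua F j => (complex.Re (kcoef F j * kks Y (vsval Z)) : R^o)).
  have lk' : linear (fun Z : g => kcoef F j * kks Y Z : R[i]^o).
    move=> a u w; rewrite /kks (brDr L) (brZr L) (killingDr L) (killingZr L).
    by rewrite mulrDr mulrCA.
  by move=> a u w; rewrite linearP; exact: (Re_lin lk').
have kAA : kks (A j) (A j : g) = 0.
  by rewrite /kks (brxx L) -(scale0r (0 : g)) (killingZr L) mul0r.
have kSS : kks (S j) (S j : g) = 0.
  by rewrite /kks (brxx L) -(scale0r (0 : g)) (killingZr L) mul0r.
have kSA : kks (S j) (A j : g) = - kks (A j) (S j : g).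
  by rewrite /kks (br_anti L) (killingNr L).
have ex (Z : Ua F j) := frame_span (uframe j) Z.
have vA : vsval (eA (uframe j) ord0) = A j by rewrite /= vsprojK // A_uroot.
have vS : vsval (eS (uframe j) ord0) = S j by rewrite /= vsprojK // S_uroot.
have ext (phi psi : 'Hom(Ua F j, R^o)) : phi (eA (uframe j) ord0) = psi (eA (uframe j) ord0) ->
    phi (eS (uframe j) ord0) = psi (eS (uframe j) ord0) -> phi = psi.
  move=> h1 h2; apply/lfunP => Z; rewrite (ex Z) big_ord1 !linearD !linearZ /=.
  by rewrite h1 h2.
split; apply: ext.
- by rewrite linfunE // vA kAA mulr0 cS_eA.
- by rewrite linfunE // vS kks_AS cS_eS eqxx.
- by rewrite opp_lfunE linfunE // vA kSA mulrN kks_AS cA_eA eqxx /= opprK.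
- by rewrite opp_lfunE linfunE // vS kSS mulr0 cA_eS /= oppr0.
Qed.

End Frames.

(** * Topology of the product of the local moduli *)

Section Topology.
Variables (R : realType) (d : nat).

Definition symplectic_points : set (modprod R d) :=
  [set p | forall j, exists x : Rstar R, p j = rpt x].
Definition complex_points : set (modprod R d) :=
  [set p | forall j, exists s, p j = zpt R s].

Lemma cvg_prod_topology (I : eqType) (K : I -> topologicalType) (U : Type)
    (F : set_system U) (FF : Filter F) (h : U -> prod_topology K) (q : prod_topology K) :
  (forall i, (fun u => h u i) @ F --> q i) -> h @ F --> q.
Proof.
move=> hc; apply/cvg_sup => i A /= [B [[C oC <-] /= Cq] BA].
apply: (@filterS _ (h @ F) _ _ _ BA).
apply: (hc i C); exact: open_nbhs_nbhs.
Qed.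

Lemma open_rpt : open (range (@rpt R) : set (modspace R)).
Proof. exact: (@existT_open_map _ (modsum R) false setT openT). Qed.

Lemma open_zpt s : open ([set zpt R s] : set (modspace R)).
Proof.
rewrite -(image_set1 (existT (modsum R) true)).
apply: (@existT_open_map _ (modsum R) true).
exact: discrete_open.
Qed.

Lemma open_symplectic_points : open symplectic_points.
Proof.
rewrite openE => p hp; rewrite /interior.
rewrite /symplectic_points.
refine (@filter_forall _ _
  (fun j (q : modprod R d) => exists x : Rstar R, q j = rpt x) (nbhs p) _ _) => j.
have [x px] := hp j.
have nV : nbhs (p j) (range (@rpt R)).
  by apply: open_nbhs_nbhs; split; [exact: open_rpt|rewrite px; exists x].
have := @proj_continuous _ (fun _ : 'I_d => modspace R) j p _ nV.
by apply: (@filterS _ (nbhs p)) => q [y _ qy]; exists y.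
Qed.

Lemma symplectic_pointsE : symplectic_points = [set p | forall j, xcoords p j != 0].
Proof.
apply/seteqP; split=> p hp j; rewrite /xcoords.
  by have [x ->] := hp j; have := valP x; rewrite inE.
have := hp j; rewrite /xcoords; case: (p j) => -[] c /=; first by rewrite eqxx.
by exists c.
Qed.

(** x_al vanishes at +0 and -0 only. *)
Lemma open_symplectic_points_xtop : open (symplectic_points : set (xtop R d)).
Proof.
exists [set q | forall j, q j != 0]; last by rewrite symplectic_pointsE.
rewrite openE => q hq; rewrite /interior.
refine (@filter_forall _ _
  (fun j (q : prod_topology (fun _ : 'I_d => (R : topologicalType))) => q j != 0 : Prop)
  (nbhs q) _ _) => j.
have nV : nbhs (q j) [set x : R | x != 0].
  by apply: open_nbhs_nbhs; split; [exact: open_neq|exact: hq].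
exact: (@proj_continuous _ (fun _ : 'I_d => R : topologicalType) j q _ nV).
Qed.

(** Moving by t the vanishing coordinates, and only these, gives a path in R^d
    that leaves the coordinate hyperplanes as soon as t is nonzero. *)
Lemma dense_symplectic_points_xtop : dense (symplectic_points : set (xtop R d)).
Proof.
move=> O [p Op] [A oA AO].
have Aq : A (xcoords p) by move: Op; rewrite -AO.
pose h (t : R) : prod_topology (fun _ : 'I_d => (R : topologicalType)) :=
  fun j => if xcoords p j == 0 then t else xcoords p j.
have h0 : h 0 = xcoords p.
  by apply/funext => j; rewrite /h; case: eqP => // ->.
have hc : h @ (0 : R) --> xcoords p.
  apply: cvg_prod_topology => j; rewrite /h; case: eqP => [->|_]; first exact: cvg_id.
  exact: cvg_cst.
have : \forall t \near (0 : R), A (h t).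
  by apply: hc; exact: open_nbhs_nbhs.
case/nbhs_ballP => e /= e0 he.
have e2 : e / 2 != 0 by rewrite lt0r_neq0 // divr_gt0.
have Ah : A (h (e / 2)).
  apply: he; rewrite /ball /= sub0r normrN gtr0_norm ?divr_gt0 //.
  by rewrite ltr_pdivrMr // ltr_pMr // ltr1n.
have hnz j : h (e / 2) j \in [set x : R | x != 0].
  by rewrite inE /= /h; case: ifP => // /negbT.
exists (fun j => rpt (SigSub (hnz j))); split; last by move=> j; eexists.
rewrite -AO /preimage /=.
by have -> : xcoords (fun j => rpt (SigSub (hnz j))) = h (e / 2) by apply/funext.
Qed.

Lemma Rstar_not_isolated (x : Rstar R) (U : set (Rstar R)) : nbhs x U ->
  exists2 y, y != x & U y.
Proof.
move=> [_ [[W oO <-] /= Ox] OU].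
have : nbhs (val x) W by exact: open_nbhs_nbhs.
case/nbhs_ballP => e /= e0 he.
have x0 : val x != 0 by have := valP x; rewrite inE.
have x0' : 0 < `|val x| by rewrite normr_gt0.
pose m := Num.min e `|val x| / 2.
have m0 : 0 < m by rewrite divr_gt0 // lt_min e0.
have me : m < e by rewrite ltr_pdivrMr // gt_min ltr_pMr // ltr1n.
have mx : m < `|val x| by rewrite ltr_pdivrMr // gt_min orbC ltr_pMr // ltr1n.
have ynz : val x + m \in [set x : R | x != 0].
  rewrite inE /= addr_eq0; apply/eqP => e1; move: mx.
  by rewrite (e1 : val x = - m) normrN gtr0_norm // ltxx.
exists (SigSub ynz).
  by apply/eqP => /(congr1 val) /= /eqP; rewrite -subr_eq0 addrAC subrr add0r gt_eqF.
apply: OU => /=; apply: he; rewrite /ball /=.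
by rewrite opprD addrA subrr sub0r normrN gtr0_norm.
Qed.

(** Varying one coordinate embeds the local moduli in the product, so an
    isolated point has only isolated coordinates, and R^* has no isolated
    point. *)
Lemma isolated_modprod : isolated [set: modprod R d] = complex_points.
Proof.
apply/seteqP; split=> p.
  move=> [_ [V Vp]]; rewrite setIT => Ve j.
  case E: (p j) => [b c]; case: b c E => c E; first by exists c.
  exfalso.
  have := @dfwith_continuous _ (fun _ : 'I_d => modspace R) p j (p j) V.
  have -> : dfwith p j (p j) = p by apply/funext => k; case: dfwithP.
  move=> /(_ Vp); rewrite E => Wx.
  have := @existT_continuous _ (modsum R) false c _ Wx.
  move=> /Rstar_not_isolated[y yx]; rewrite /= Ve => /(congr1 (fun q => q j)).
  rewrite /= dfwithin E => h; move/eqP: yx; apply.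
  have := congr1 (@xcoord R) h => /= h'; exact: val_inj.
move=> hp; split; first by rewrite inE.
exists [set p]; last by rewrite setIT.
have : \forall q \near p, forall j, q j = p j.
  refine (@filter_forall _ _ (fun j (q : modprod R d) => q j = p j) (nbhs p) _ _) => j.
  have [s ps] := hp j.
  have nV : nbhs (p j) [set zpt R s].
    by apply: open_nbhs_nbhs; split; [exact: open_zpt|rewrite ps].
  have := @proj_continuous _ (fun _ : 'I_d => modspace R) j p _ nV.
  by apply: (@filterS _ (nbhs p)) => q qs; rewrite ps; exact: qs.
by apply: filterS => q hq; apply/funext.
Qed.

Lemma card_complex_points : (complex_points #= `I_(2 ^ d))%card.
Proof.
have e : (2 ^ d = #|{ffun 'I_d -> bool}|)%N by rewrite card_ffun card_bool card_ord.
pose g (k : 'I_(2 ^ d)) : modprod R d :=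
  fun j => zpt R ((enum_val (cast_ord e k) : {ffun 'I_d -> bool}) j).
have gi : injective g.
  move=> k l kl; apply: (@cast_ord_inj _ _ e); apply: enum_val_inj; apply/ffunP => j.
  have : g k j = g l j by rewrite kl.
  pose sign (q : modspace R) := match q with existT true s => s | _ => false end.
  by move=> /(congr1 sign).
have -> : complex_points = g @` [set: 'I_(2 ^ d)].
  apply/seteqP; split=> [p hp|_ [k _ <-] j]; last by eexists.
  pose s := [ffun j => sval (cid (hp j))].
  exists (cast_ord (esym e) (enum_rank s)) => //.
  apply/funext => j; rewrite /g cast_ordKV enum_rankK ffunE.
  by case: cid.
apply: card_eq_trans (_ : [set: 'I_(2 ^ d)] #= _)%card.
  by apply: inj_card_eq => k l _ _; exact: gi.
by rewrite card_eq_sym; exact: card_II.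
Qed.

End Topology.

(** * Matrices of a block *)

Lemma sum_ord4 (V : zmodType) (g : 'I_4 -> V) :
  \sum_k g k = g (inord 0) + g (inord 1) + g (inord 2) + g (inord 3).
Proof.
rewrite !big_ord_recl big_ord0 addr0 !addrA.
by congr (g _ + g _ + g _ + g _); apply: val_inj; rewrite /= inordK.
Qed.

Section SingleBlock.
Variables (R : realType).

Definition mx_of_block (n : block R) : 'M[R]_4 := mx4
  [:: [:: blk_a n; - blk_s n;      0; - blk_x n];
      [:: blk_s n;   blk_a n;   blk_x n;      0];
      [::    0; - blk_y n; - blk_a n; - blk_s n];
      [:: blk_y n;      0;   blk_s n; - blk_a n] ].

Lemma cJ0_block : cJ0 R = mx_of_block (Block 0 1 0 0).
Proof. by apply/matrixP => k l; rewrite !mxE /= !oppr0. Qed.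

Lemma cJ0N_block : - cJ0 R = mx_of_block (Block 0 (-1) 0 0).
Proof.
apply/matrixP => k l; rewrite !mxE.
by case: k => [[|[|[|[|//]]]] kl]; case: l => [[|[|[|[|//]]]] ll];
  rewrite /= ?oppr0 ?opprK.
Qed.

Lemma ncJ_block a x y : ncJ a x y = mx_of_block (Block a 0 x y).
Proof. by apply/matrixP => k l; rewrite !mxE /= !oppr0. Qed.


Variables (V : vectType R) (T : zmodType) (tor : set T) (rho : T -> 'End(V)).
Variables (f : rotframe tor rho 'I_1).

Definition acts_on_frame (J : 'End(gen V)) (n : block R) : Prop :=
  [/\ J (vecA f ord0) = blk_a n *: vecA f ord0 + blk_s n *: vecS f ord0
                         + 0 *: covA f ord0 + blk_y n *: covS f ord0,
      J (vecS f ord0) = - blk_s n *: vecA f ord0 + blk_a n *: vecS f ord0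
                         + - blk_y n *: covA f ord0 + 0 *: covS f ord0,
      J (covA f ord0) = 0 *: vecA f ord0 + blk_x n *: vecS f ord0
                         + - blk_a n *: covA f ord0 + blk_s n *: covS f ord0
    & J (covS f ord0) = - blk_x n *: vecA f ord0 + 0 *: vecS f ord0
                         + - blk_s n *: covA f ord0 + - blk_a n *: covS f ord0].

(** The columns of the matrix determine J on a basis, so it is enough to compare
    with one structure acting by the given block. *)
Lemma matrix_acts (w : 'I_4 -> gen V) (J : 'End(gen V)) n :
  w (inord 0) = vecA f ord0 -> w (inord 1) = vecS f ord0 ->
  w (inord 2) = covA f ord0 -> w (inord 3) = covS f ord0 ->
  (forall l, J (w l) = \sum_(k < 4) mx_of_block n k l *: w k) <-> acts_as f J ord0 n.
Proof.
move=> e0 e1 e2 e3.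
have expand l : \sum_(k < 4) mx_of_block n k l *: w k =
    mx_of_block n (inord 0) l *: vecA f ord0 + mx_of_block n (inord 1) l *: vecS f ord0 +
    mx_of_block n (inord 2) l *: covA f ord0 + mx_of_block n (inord 3) l *: covS f ord0.
  by rewrite sum_ord4 e0 e1 e2 e3.
have E k l : (k < 4)%N -> (l < 4)%N -> mx_of_block n (inord k) (inord l) =
    (nth [::] [:: [:: blk_a n; - blk_s n; 0; - blk_x n]; [:: blk_s n; blk_a n; blk_x n; 0];
    [:: 0; - blk_y n; - blk_a n; - blk_s n]; [:: blk_y n; 0; blk_s n; - blk_a n] ] k)`_l.
  by move=> k4 l4; rewrite !mxE !inordK.
have c0 := expand (inord 0); rewrite !E //= in c0.
have c1 := expand (inord 1); rewrite !E //= in c1.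
have c2 := expand (inord 2); rewrite !E //= in c2.
have c3 := expand (inord 3); rewrite !E //= in c3.
have key : (forall l, J (w l) = \sum_(k < 4) mx_of_block n k l *: w k) <->
  acts_on_frame J n.
  split=> [H|[H0 H1 H2 H3] l].
    by split; [rewrite -c0 -e0|rewrite -c1 -e1|rewrite -c2 -e2|rewrite -c3 -e3]; exact: H.
  have : [|| l == inord 0, l == inord 1, l == inord 2 | l == inord 3].
    by case: l => [[|[|[|[|//]]]] ll]; rewrite -!val_eqE /= !inordK.
  case/or4P => /eqP ->.
  - rewrite c0 e0; exact: H0.
  - rewrite c1 e1; exact: H1.
  - rewrite c2 e2; exact: H2.
  - rewrite c3 e3; exact: H3.
move: key => {c0 c1 c2 c3 E expand} key.
rewrite key.
have [a0 a1 a2 a3] := vecA_coord f ord0 ord0; have [b0 b1 b2 b3] := vecS_coord f ord0 ord0.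
have [c0 c1 c2 c3] := covA_coord f ord0 ord0; have [d0 d1 d2 d3] := covS_coord f ord0 ord0.
have lc0 (u v t z : R) p q r s : xA f ord0 (u *: p + v *: q + t *: r + z *: s)
    = u * xA f ord0 p + v * xA f ord0 q + t * xA f ord0 r + z * xA f ord0 s.
  by rewrite !(linearD, linearZ).
have lc1 (u v t z : R) p q r s : xS f ord0 (u *: p + v *: q + t *: r + z *: s)
    = u * xS f ord0 p + v * xS f ord0 q + t * xS f ord0 r + z * xS f ord0 s.
  by rewrite !(linearD, linearZ).
have lc2 (u v t z : R) p q r s : yA f ord0 (u *: p + v *: q + t *: r + z *: s)
    = u * yA f ord0 p + v * yA f ord0 q + t * yA f ord0 r + z * yA f ord0 s.
  by rewrite !(linearD, linearZ).
have lc3 (u v t z : R) p q r s : yS f ord0 (u *: p + v *: q + t *: r + z *: s)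
    = u * yS f ord0 p + v * yS f ord0 q + t * yS f ord0 r + z * yS f ord0 s.
  by rewrite !(linearD, linearZ).
have to K : acts_as f K ord0 n -> acts_on_frame K n.
  move=> a; split; apply: (gen_ext (f := f)) => i; rewrite ord1 lc0 lc1 lc2 lc3.
  - have [-> -> -> ->] := a (vecA f ord0).
    by rewrite a0 a1 a2 a3 b0 b1 b2 b3 c0 c1 c2 c3 d0 d1 d2 d3 eqxx; split; ring.
  - have [-> -> -> ->] := a (vecS f ord0).
    by rewrite a0 a1 a2 a3 b0 b1 b2 b3 c0 c1 c2 c3 d0 d1 d2 d3 eqxx; split; ring.
  - have [-> -> -> ->] := a (covA f ord0).
    by rewrite a0 a1 a2 a3 b0 b1 b2 b3 c0 c1 c2 c3 d0 d1 d2 d3 eqxx; split; ring.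
  - have [-> -> -> ->] := a (covS f ord0).
    by rewrite a0 a1 a2 a3 b0 b1 b2 b3 c0 c1 c2 c3 d0 d1 d2 d3 eqxx; split; ring.
split=> [[H0 H1 H2 H3]|]; last exact: to.
have aK := of_blocks_acts f (fun _ => n).
have [K0 K1 K2 K3] := to _ (aK ord0).
suff -> : J = of_blocks f (fun _ => n) by exact: aK.
have LC (M : 'End(gen V)) p : M p = xA f ord0 p *: M (vecA f ord0)
    + xS f ord0 p *: M (vecS f ord0) + yA f ord0 p *: M (covA f ord0)
    + yS f ord0 p *: M (covS f ord0).
  by rewrite {1}(gen_span f p) big_ord1 !(linearD, linearZ).
by apply/lfunP => p; rewrite (LC J p) (LC (of_blocks f (fun _ => n)) p) H0 H1 H2 H3 K0 K1 K2 K3.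
Qed.

(** An alternating form on a plane is a multiple of the area form. *)
Lemma single_form_inv b : alternating b -> inv_form tor rho b.
Proof.
move=> ab H tH X Y.
rewrite (form_expand f b (rho H X)) (form_expand f b X) !big_ord1.
rewrite (alternating_anti (eA f ord0) _ ab) (alternating_anti (eS f ord0) _ ab).
rewrite [in RHS](alternating_anti (eA f ord0) _ ab) [in RHS](alternating_anti (eS f ord0) _ ab).
rewrite !(form_expand f b (rho H Y)) !(form_expand f b Y) !big_ord1 !ab !mulr0 add0r addr0.
rewrite add0r addr0 (alternating_anti (eS f ord0) (eA f ord0) ab).
have [e0 e1 _ _] := gact_coord f ord0 (X, 0) tH.
have [g0 g1 _ _] := gact_coord f ord0 (Y, 0) tH.
move: e0 e1 g0 g1; rewrite /xA /xS [X in X = _ -> _]/= [X in _ -> X = _ -> _]/=.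
move=> -> -> /= -> ->.
have := cos2Dsin2 (angle f ord0 H) => cs.
set u := b _ _; set c := cos _ in cs *; set s := sin _ in cs *.
rewrite -[RHS]mul1r -cs; ring.
Qed.

End SingleBlock.

Section Matrices.
Variables (R : realType) (d : nat) (F : flag_datum R d) (j : 'I_d).
Local Notation f := (uframe F j).

Lemma has_matrixP (J : 'End(gen (Ua F j))) n :
  has_matrix J (mx_of_block n) <-> acts_as f J ord0 n.
Proof.
have [sA sS] := starE F j.
apply: matrix_acts; rewrite (tnth_nth 0) /= inordK //= ?sS ?sA //.
Qed.

Lemma block_class_param (J : Jroot F j) n p : block_ok n ->
  acts_as f (val J) ord0 n -> block_point n p -> class_param J p.
Proof.
case: n => [a s q r] ok /has_matrixP hm; case: p => -[] c /=.
  move=> e; case: ok => [[s0 _]|[p0 q0 r0 _]].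
    by move: s0 => /= s0; exfalso; move: e; rewrite s0; case: (c) => h; lra.
  move: p0 q0 r0 => /= p0 q0 r0; move: hm; rewrite p0 q0 r0 e.
  by case: (c) => hm; [rewrite cJ0_block|rewrite cJ0N_block].
move=> [s0 qx]; case: ok => [[_ qr]|[_ q0 _ s1]]; last first.
  by move: s1; rewrite /= s0 expr0n /= => /eqP; rewrite eq_sym oner_eq0.
have qr' : q * r = a ^+ 2 + 1 by exact: qr.
exists a, r; rewrite -qx; split; first by rewrite qr'; ring.
by rewrite ncJ_block -s0.
Qed.

Lemma noncomplex_point (J : Jroot F j) n p : noncomplex_type J ->
  block_ok n -> acts_as f (val J) ord0 n -> block_point n p -> exists x, p = rpt x.
Proof.
move=> [a [x [y [_ hm]]]] ok an; rewrite ncJ_block in hm.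
move/has_matrixP: hm => hm; rewrite (acts_as_inj an hm).
case: p => -[] c /=; last by move=> _; exists c.
by case: (c) => h; exfalso; lra.
Qed.

Lemma complex_point (J : Jroot F j) n p : complex_type J ->
  block_ok n -> acts_as f (val J) ord0 n -> block_point n p -> exists s, p = zpt R s.
Proof.
move=> h ok an.
have sn : blk_s n = 1 \/ blk_s n = -1.
  case: h => hm; [rewrite cJ0_block in hm; left|rewrite cJ0N_block in hm; right];
  by move/has_matrixP: hm => hm; rewrite (acts_as_inj an hm).
case: p => -[] c /=; first by exists c.
by case=> s0 _; exfalso; case: sn; rewrite s0 => h'; lra.
Qed.

Lemma alt_forms_inv b : fgset (alt_forms (Ua F j)) b <->
  alternating b /\ inv_form (@tor R d F) (AdT (uroot F j)) b.
Proof. by split=> [ab|[]//]; split=> //; exact: (single_form_inv f). Qed.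

End Matrices.

(** * The moduli space *)

Theorem corollary5p15 (R : realType) (d : nat) (F : flag_datum R d) :
  exists (Theta : Ma F -> forall j : 'I_d, Mroot F j)
         (phi : forall j : 'I_d, Mroot F j -> modspace R),
    let Psi : Ma F -> modprod R d := fun m j => phi j (Theta m j) in
    [/\ bijective Theta
        /\ (forall J : Ja F, exists Js : forall j : 'I_d, Jroot F j,
              splits J Js /\ forall j, Theta (cls _ J) j = cls _ (Js j)),
        forall j : 'I_d, bijective (phi j)
          /\ (forall J : Jroot F j, class_param J (phi j (cls _ J))),
        [/\ Psi @` symplectic_classes F =
              [set p | forall j, exists x : Rstar R, p j = rpt x],
            open (Psi @` symplectic_classes F),
            open (Psi @` symplectic_classes F : set (xtop R d))
          & dense (Psi @` symplectic_classes F : set (xtop R d))]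
      & isolated setT = Psi @` complex_classes F
        /\ (Psi @` complex_classes F #= `I_(2 ^ d))%card ].
Proof.
have GN b : fgset (inv_alt_forms (@tor R d F) (AdT (nminus F))) b <->
    Defs.alternating b /\ inv_form (@tor R d F) (AdT (nminus F)) b by [].
have [Psi0 [[Xi Psi0K XiK] Psi0P]] := moduli_param (nframe F) GN.
have U j := moduli_param (uframe F j) (@alt_forms_inv R d F j).
pose psi j := sval (cid (U j)).
have psiP j := svalP (cid (U j)).
pose phi j (m : Mroot F j) : modspace R := psi j m ord0.
have phi_bij j : bijective (phi j).
  have [[xi psiK xiK] _] := psiP j.
  apply: inj_surj_bij => [m m' e|p].
    apply: (can_inj psiK); apply/funext => i; rewrite ord1; exact: e.
  by exists (xi (fun=> p)); rewrite /phi /psi xiK.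
have phiP j (J : Jroot F j) : exists n,
    [/\ block_ok n, acts_as (uframe F j) (val J) ord0 n & block_point n (phi j (cls _ J))].
  by have [_ h] := psiP j; exact: h.
have phi_surj j p : exists m, phi j m = p.
  by case: (phi_bij j) => g _ gK; exists (g p).
pose phiV j p : Mroot F j := sval (cid (phi_surj j p)).
have phiVK j : cancel (phiV j) (phi j) by move=> p; exact: svalP (cid (phi_surj j p)).
have phiK j : cancel (phi j) (phiV j).
  by move=> m; apply: (bij_inj (phi_bij j)); rewrite phiVK.
(* gincl j embeds the block of u_j as block j, so a block decomposition has no
   freedom *)
have split_eq (J : Ja F) (Js : forall j, Jroot F j) : splits J Js ->
    forall j, phi j (cls _ (Js j)) = Psi0 (cls _ J) j.
  move=> sp j; have [n [_ aJ cJ]] := Psi0P J j; have [m [_ am cm]] := phiP j (Js j).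
  by apply: same_block_point cm cJ _; rewrite (gincl_block aJ am (sp j)).
have split_ex (J : Ja F) : exists Js : forall j, Jroot F j, splits J Js.
  pose n j := sval (cid (Psi0P J j)).
  have nP j : [/\ block_ok (n j), acts_as (nframe F) (val J) j (n j)
      & block_point (n j) (Psi0 (cls _ J) j)] by exact: svalP (cid (Psi0P J j)).
  have aU j := of_blocks_acts (uframe F j) (fun _ => n j).
  have JS j : of_blocks (uframe F j) (fun _ => n j) \in Jroot F j.
    by apply: acts_as_gacs (aU j) => _; case: (nP j).
  exists (fun j => SigSub (JS j)) => j p.
  apply: (@block_gincl _ _ _ _ _ _ n) => [k|]; first by case: (nP k).
  exact: aU.
(* the two parametrizations by points of the local moduli are compared *)
pose Theta (m : Ma F) j := phiV j (Psi0 m j).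
have ThetaE m j : phi j (Theta m j) = Psi0 m j by rewrite /Theta phiVK.
exists Theta, phi => Psi.
have PsiE : Psi = Psi0 :> (Ma F -> modprod R d).
  by apply/funext => m; apply/funext => j; exact: ThetaE.
have clsK (m : Ma F) : cls _ (repr m) = m by rewrite /cls reprK.
have symE : Psi @` symplectic_classes F = @symplectic_points R d.
  rewrite PsiE; apply/seteqP; split=> [_ [_ [J [Js [-> sp nc]]] <-] j|p hp].
    rewrite -(split_eq J Js sp j); have [m [ok am cm]] := phiP j (Js j).
    exact: noncomplex_point (nc j) ok am cm.
  exists (Xi p); last by rewrite XiK.
  pose J : Ja F := repr (Xi p); have [Js sp] := split_ex J.
  exists J, Js; split; [by rewrite clsK|exact: sp|move=> j].
  have := split_eq J Js sp j; rewrite clsK XiK; have [x ->] := hp j => e.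
  have [m [ok am cm]] := phiP j (Js j).
  have := block_class_param ok am cm; rewrite e => -[a [y h]].
  by exists a, (val x), y.
have cplxE : Psi @` complex_classes F = @complex_points R d.
  rewrite PsiE; apply/seteqP; split=> [_ [_ [J [Js [-> sp nc]]] <-] j|p hp].
    rewrite -(split_eq J Js sp j); have [m [ok am cm]] := phiP j (Js j).
    exact: complex_point (nc j) ok am cm.
  exists (Xi p); last by rewrite XiK.
  pose J : Ja F := repr (Xi p); have [Js sp] := split_ex J.
  exists J, Js; split; [by rewrite clsK|exact: sp|move=> j].
  have := split_eq J Js sp j; rewrite clsK XiK; have [s ->] := hp j => e.
  have [m [ok am cm]] := phiP j (Js j).
  have := block_class_param ok am cm; rewrite e.
  by case: (s) => h; [left|right].
split.
- split.
    apply: inj_surj_bij => [m m' e|t].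
      apply: (can_inj Psi0K); apply/funext => j; rewrite -!ThetaE.
      by rewrite e.
    exists (Xi (fun j => phi j (t j))); apply: functional_extensionality_dep => j.
    by rewrite /Theta XiK phiK.
  move=> J; have [Js sp] := split_ex J; exists Js; split=> // j.
  by rewrite /Theta -(split_eq J Js sp j) phiK.
- move=> j; split=> // J; have [n [ok an cn]] := phiP j J.
  exact: block_class_param ok an cn.
- rewrite symE; split=> //; first exact: open_symplectic_points.
    exact: open_symplectic_points_xtop.
  exact: dense_symplectic_points_xtop.
- by rewrite cplxE; split; [exact: isolated_modprod|exact: card_complex_points].
Qed.
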